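(* Let $f(x)=x+ax^{m+1}+\cdots$ and $g(x)=x+a'x^{m'+1}+\cdots$ be $\mathbb{Q}_p$-analytic functions with $m,m'\ge 1$ and $a,a'\neq 0$ (the omitted terms having higher degree). Then $f$ and $g$ are conjugate via a homeomorphism $h:U_1\to U_2$ between neighborhoods $U_1$, $U_2$ of $0$ in $\mathbb{Q}_p$, where $f(U_1)=U_1$, $g(U_2)=U_2$, $h(0)=0$ and $h\circ f=g\circ h$ on $U_1$. Suppose that $m\le m'$. Then $h$ and a constant $C>0$ may be chosen such that $$|h(x)|\le C|x|^{\frac{m}{m'}}\quad\text{for all } x\in U_1.$$ This exponent cannot be improved: if $\alpha>\frac{m}{m'}$, there do not exist such a conjugating homeomorphism $h:U_1\to U_2$ and a constant $C>0$ with $|h(x)|\le C|x|^{\alpha}$ for all $x\in U_1$. Moreover (for the chosen $h$ and $C$), if $x,y\in U_1$ are in the same $\mathbb{Z}_p$-orbit of $f$, then $$|h(y)-h(x)|\le C|y-x|^{\frac{m}{m'}},$$ and if $x,y\in U_2$ are in the same $\mathbb{Z}_p$-orbit of $g$, then $$|h^{-1}(y)-h^{-1}(x)|\le C|y-x|^{\frac{m}{m'}}.$$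
   Context: $\mathbb{Q}_p$ carries the norm with $|p|=1/p$. A power series over $\mathbb{Q}_p$ is $\mathbb{Q}_p$-analytic if it has positive radius of convergence at $0$. For a point $x$ near $0$, the $\mathbb{Z}_p$-orbit of $x$ under $f$ is the closure in $\mathbb{Q}_p$ of the forward orbit $\{f^{\circ n}(x)\mid n\in\mathbb{Z}_{\geq 0}\}$. *)

(* Defs.v *)
From HB Require Import structures.
From mathcomp Require Import all_boot all_order all_algebra.
From mathcomp Require Import ring lra generic_quotient ring_quotient.
From mathcomp Require Import all_classical all_reals all_analysis.
Import Order.TTheory GRing.Theory Num.Theory.
Import numFieldNormedType.Exports.

Set Implicit Arguments.
Unset Strict Implicit.
Unset Printing Implicit Defensive.

Local Open Scope classical_set_scope.
Local Open Scope ring_scope.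

Section PadicAbs.
Variables (R : realType) (p : nat) (p_pr : prime p).

Definition padic_abs (x : rat) : R :=
  if x == 0 then 0
  else p%:R ^+ logn p `|denq x|%N / p%:R ^+ logn p `|numq x|%N.

Let p0 : (p%:R : R) != 0.
Proof. by rewrite pnatr_eq0 -lt0n prime_gt0. Qed.

Lemma padic_abs0 : padic_abs 0 = 0.
Proof. by rewrite /padic_abs eqxx. Qed.

Lemma padic_abs_frac (a b : int) : a != 0 -> b != 0 ->
  padic_abs (a%:~R / b%:~R) =
    p%:R ^+ logn p `|b|%N / p%:R ^+ logn p `|a|%N.
Proof.
move=> a0 b0; rewrite /padic_abs mulf_eq0 invr_eq0 !intq_eq0.
rewrite (negbTE a0) (negbTE b0) /=.
set x := a%:~R / b%:~R.
have x0 : x != 0 by rewrite mulf_eq0 invr_eq0 !intq_eq0 negb_or a0.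
have E : (a * denq x = numq x * b)%R.
  apply: (@intr_inj rat); rewrite !intrM.
  have d0 : (denq x)%:~R != 0 :> rat by rewrite intq_eq0 denq_neq0.
  have b0' : b%:~R != 0 :> rat by rewrite intq_eq0.
  have := divq_num_den x; rewrite {3}/x => /eqP.
  by rewrite eqr_div // => /eqP ->; rewrite mulrC.
have N : (logn p `|a| + logn p `|denq x| = logn p `|numq x| + logn p `|b|)%N.
  by rewrite -!lognM ?absz_gt0 ?denq_neq0 ?numq_eq0 // -!abszM E.
apply/eqP; rewrite eqr_div ?expf_neq0 // -!exprD.
by rewrite addnC N addnC.
Qed.

Lemma padic_abs_gt0 x : x != 0 -> 0 < padic_abs x.
Proof.
by move=> x0; rewrite /padic_abs (negbTE x0) divr_gt0 // exprn_gt0 //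
  ltr0n prime_gt0.
Qed.

Lemma padic_abs_ge0 x : 0 <= padic_abs x.
Proof.
have [->|/padic_abs_gt0 /ltW //] := eqVneq x 0; by rewrite padic_abs0.
Qed.

Lemma padic_abs_eq0 x : (padic_abs x == 0) = (x == 0).
Proof.
have [->|/padic_abs_gt0 h] := eqVneq x 0; first by rewrite padic_abs0 eqxx.
by rewrite gt_eqF.
Qed.

Lemma padic_abs1 : padic_abs 1 = 1.
Proof.
have := @padic_abs_frac 1 1 isT isT.
by rewrite divr1 absz1 logn1 expr0 divr1.
Qed.

Lemma padic_absp : padic_abs p%:R = p%:R^-1.
Proof.
have pz : (p%:Z != 0) by rewrite eqz_nat -lt0n prime_gt0.
have := @padic_abs_frac p%:Z 1 pz isT.
by rewrite divr1 absz1 logn1 expr0 div1r logn_prime // eqxx expr1.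
Qed.

Lemma padic_absM x y : padic_abs (x * y) = padic_abs x * padic_abs y.
Proof.
have [->|x0] := eqVneq x 0; first by rewrite mul0r padic_abs0 mul0r.
have [->|y0] := eqVneq y 0; first by rewrite mulr0 padic_abs0 mulr0.
have nx : numq x != 0 by rewrite numq_eq0.
have ny : numq y != 0 by rewrite numq_eq0.
rewrite -{1}[x]divq_num_den -{1}[y]divq_num_den mulf_div -!intrM.
rewrite padic_abs_frac ?mulf_neq0 ?denq_neq0 // !abszM.
rewrite !lognM ?absz_gt0 ?denq_neq0 // !exprD.
by rewrite /padic_abs (negbTE x0) (negbTE y0) mulf_div.
Qed.

Lemma padic_absN x : padic_abs (- x) = padic_abs x.
Proof. by rewrite /padic_abs oppr_eq0 numqN denqN abszN. Qed.

Lemma padic_absB x y : padic_abs (x - y) = padic_abs (y - x).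
Proof. by rewrite -padic_absN opprB. Qed.

Lemma padic_absV x : padic_abs x^-1 = (padic_abs x)^-1.
Proof.
have [->|x0] := eqVneq x 0; first by rewrite invr0 padic_abs0 invr0.
have a0 : padic_abs x != 0 by rewrite padic_abs_eq0.
by apply: (mulfI a0); rewrite -padic_absM !divff // padic_abs1.
Qed.

Lemma padic_abs_ultra x y :
  padic_abs (x + y) <= Num.max (padic_abs x) (padic_abs y).
Proof.
have [->|x0] := eqVneq x 0; first by rewrite add0r le_max lexx orbT.
have [->|y0] := eqVneq y 0; first by rewrite addr0 le_max lexx.
have [->|xy0] := eqVneq (x + y) 0.
  by rewrite padic_abs0 le_max padic_abs_ge0.
set a := numq x * denq y; set b := numq y * denq x; set d := denq x * denq y.
have dx0 : (denq x)%:~R != 0 :> rat by rewrite intq_eq0 denq_neq0.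
have dy0 : (denq y)%:~R != 0 :> rat by rewrite intq_eq0 denq_neq0.
have Ex : x = a%:~R / d%:~R.
  by rewrite /a /d !intrM -mulf_div divff // mulr1 divq_num_den.
have Ey : y = b%:~R / d%:~R.
  rewrite /b /d !intrM [_ * (denq y)%:~R]mulrC -mulf_div divff // mulr1.
  by rewrite divq_num_den.
have a0 : a != 0 by rewrite mulf_neq0 ?numq_eq0 ?denq_neq0.
have b0 : b != 0 by rewrite mulf_neq0 ?numq_eq0 ?denq_neq0.
have d0 : d != 0 by rewrite mulf_neq0 ?denq_neq0.
have Exy : x + y = (a + b)%:~R / d%:~R by rewrite Ex Ey -mulrDl intrD.
have ab0 : a + b != 0.
  by apply: contraNneq xy0; rewrite Exy => ->; rewrite mul0r.
clearbody a b d.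
rewrite Exy Ex Ey !padic_abs_frac //.
have p1 : 1 <= p%:R :> R by rewrite ler1n prime_gt0.
have mono (k l : nat) : (k <= l)%N -> p%:R ^+ logn p `|d| / p%:R ^+ l <=
    p%:R ^+ logn p `|d| / p%:R ^+ k :> R.
  move=> kl; rewrite ler_wpM2l ?exprn_ge0 //.
  rewrite lef_pV2 ?posrE ?exprn_gt0 ?ltr0n ?prime_gt0 //.
  exact: ler_weXn2l.
have key : (minn (logn p `|a|) (logn p `|b|) <= logn p `|(a + b)%R|)%N.
  set k := minn _ _.
  rewrite -pfactor_dvdn ?absz_gt0 //.
  have da : ((p ^ k)%N%:Z %| a)%Z.
    by rewrite dvdzE /= pfactor_dvdn ?absz_gt0 // geq_minl.
  have db : ((p ^ k)%N%:Z %| b)%Z.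
    by rewrite dvdzE /= pfactor_dvdn ?absz_gt0 // geq_minr.
  by have := rpredD da db; rewrite dvdzE.
rewrite le_max; have [lab|lba] := leqP (logn p `|a|) (logn p `|b|).
  by rewrite mono // (leq_trans _ key) // leq_min leqnn.
by rewrite [X in _ || X]mono ?orbT // (leq_trans _ key) // leq_min leqnn ltnW.
Qed.

Lemma padic_absD x y : padic_abs (x + y) <= padic_abs x + padic_abs y.
Proof.
apply: le_trans (padic_abs_ultra _ _) _.
by rewrite ge_max lerDl lerDr !padic_abs_ge0.
Qed.

Lemma padic_abs_eq x y : padic_abs (x - y) < padic_abs x ->
  padic_abs y = padic_abs x.
Proof.
move=> h; apply/le_anti/andP; split.
  have := padic_abs_ultra (y - x) x; rewrite subrK padic_absB.
  by move/le_trans; apply; rewrite ge_max lexx ltW.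
have := padic_abs_ultra (x - y) y; rewrite subrK le_max.
by rewrite leNgt h.
Qed.

End PadicAbs.

Section Cauchy.
Variables (R : realType) (p : nat) (p_pr : prime p).
Local Notation abs := (padic_abs R p).

Definition padic_cauchy (u : nat -> rat) : bool :=
  `[< forall e : R, 0 < e ->
      exists N, forall i j, (N <= i)%N -> (N <= j)%N -> abs (u i - u j) < e >].

Definition padic_null (u : nat -> rat) : Prop :=
  forall e : R, 0 < e -> exists N, forall i, (N <= i)%N -> abs (u i) < e.

Lemma padic_cauchy_bound u : padic_cauchy u ->
  exists N M, 0 < M /\ forall i, (N <= i)%N -> abs (u i) < M.
Proof.
move/asboolP/(_ 1 ltr01) => [N hN]; exists N, (1 + abs (u N)).
have h0 := padic_abs_ge0 R p_pr (u N).
split=> [|i Ni]; first by rewrite (lt_le_trans ltr01) // lerDl.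
rewrite -[u i](subrK (u N)) (le_lt_trans (padic_absD R p_pr _ _)) //.
by rewrite ltrD2r hN.
Qed.

Lemma padic_null_cauchy u : padic_null u -> padic_cauchy u.
Proof.
move=> nu; apply/asboolP => e /nu[N hN]; exists N => i j /hN hi /hN hj.
rewrite (le_lt_trans (padic_abs_ultra R p_pr _ _)) // padic_absN.
by rewrite gt_max hi.
Qed.

Lemma padic_nullB u v : padic_null u -> padic_null v ->
  padic_null (fun i => u i - v i).
Proof.
move=> nu nv e e0; have [N hN] := nu e e0; have [M hM] := nv e e0.
exists (maxn N M) => i; rewrite geq_max => /andP[/hN hi /hM hi'].
rewrite (le_lt_trans (padic_abs_ultra R p_pr _ _)) // padic_absN.
by rewrite gt_max hi.
Qed.

Lemma padic_nullM u v : padic_cauchy u -> padic_null v ->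
  padic_null (fun i => u i * v i).
Proof.
move=> /padic_cauchy_bound[N [M [M0 hM]]] nv e e0.
have [K hK] := nv (e / M) (divr_gt0 e0 M0).
exists (maxn N K) => i; rewrite geq_max => /andP[/hM hi /hK hi'].
rewrite padic_absM //.
apply: le_lt_trans (ler_wpM2r (padic_abs_ge0 R p_pr _) (ltW hi)) _.
by rewrite mulrC -ltr_pdivlMr.
Qed.

(* A nonnull Cauchy sequence has eventually constant absolute value. *)
Lemma padic_cauchy_const u : padic_cauchy u -> ~ padic_null u ->
  exists N c, 0 < c /\ forall i, (N <= i)%N -> abs (u i) = c.
Proof.
move=> /asboolP cu nu.
have [e [e0 he]] : exists e : R, 0 < e /\
    forall N, exists i, (N <= i)%N /\ e <= abs (u i).
  apply: contrapT => h; apply: nu => e e0.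
  apply: contrapT => h'; apply: h; exists e; split=> // N.
  apply: contrapT => h; apply: h'; exists N => i Ni.
  by rewrite ltNge; apply/negP => ei; apply: h; exists i.
have [N hN] := cu e e0; have [k [Nk ek]] := he N.
exists N, (abs (u k)); split=> [|i Ni]; first exact: lt_le_trans ek.
by apply: padic_abs_eq => //; apply: lt_le_trans ek; exact: hN.
Qed.

Lemma padic_cauchy_subring : subring_closed padic_cauchy.
Proof.
split=> [|u v /asboolP cu /asboolP cv|u v bu bv]; apply/asboolP => e e0.
- by exists 0%N => i j _ _; rewrite subrr padic_abs0.
- have [N hN] := cu e e0; have [M hM] := cv e e0.
  exists (maxn N M) => i j; rewrite !geq_max => /andP[Ni Mi] /andP[Nj Mj].
  rewrite (_ : _ - _ = (u i - u j) + (v j - v i)); last by rewrite !fctE; ring.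
  rewrite (le_lt_trans (padic_abs_ultra R p_pr _ _)) // gt_max.
  by rewrite hN // hM.
- have [N1 [A [A0 hA]]] := padic_cauchy_bound bu.
  have [N2 [B [B0 hB]]] := padic_cauchy_bound bv.
  have [N3 hN] := (asboolW bu) _ (divr_gt0 e0 B0).
  have [N4 hM] := (asboolW bv) _ (divr_gt0 e0 A0).
  exists (maxn (maxn N1 N2) (maxn N3 N4)) => i j.
  rewrite !geq_max => /andP[/andP[i1 i2] /andP[i3 i4]].
  move=> /andP[/andP[j1 j2] /andP[j3 j4]].
  rewrite (_ : _ - _ = (u i - u j) * v i + u j * (v i - v j)); last first.
    by rewrite !fctE; ring.
  rewrite (le_lt_trans (padic_abs_ultra R p_pr _ _)) // gt_max !padic_absM //.
  apply/andP; split.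
    apply: le_lt_trans (ler_wpM2l (padic_abs_ge0 R p_pr _) (ltW (hB _ i2))) _.
    by rewrite -ltr_pdivlMr // hN.
  apply: le_lt_trans (ler_wpM2r (padic_abs_ge0 R p_pr _) (ltW (hA _ j1))) _.
  by rewrite mulrC -ltr_pdivlMr // hM.
Qed.

End Cauchy.

(* [prime p] is an argument, although unused, so that the ring structures below
   can be inferred. *)
Definition cauchy_pred (R : realType) (p : nat) of prime p : {pred nat -> rat} :=
  @padic_cauchy R p.

HB.instance Definition _ (R : realType) p (p_pr : prime p) :=
  GRing.isSubringClosed.Build _ (cauchy_pred R p_pr)
    (padic_cauchy_subring R p_pr).

Record cauchy_seq (R : realType) (p : nat) (p_pr : prime p) := CauchySeq {
  cauchy_val :> nat -> rat ;
  cauchy_valP : cauchy_val \in cauchy_pred R p_pr }.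

HB.instance Definition _ R p (p_pr : prime p) :=
  [isSub for @cauchy_val R p p_pr].
HB.instance Definition _ R p (p_pr : prime p) :=
  [Choice of cauchy_seq R p_pr by <:].
HB.instance Definition _ R p (p_pr : prime p) :=
  [SubChoice_isSubComNzRing of cauchy_seq R p_pr by <:].

Definition null_ideal R p (p_pr : prime p) : {pred cauchy_seq R p_pr} :=
  fun u => `[< padic_null R p u >].
Arguments null_ideal R [p] p_pr _.

Lemma null_idealP R p (p_pr : prime p) : idealr_closed (null_ideal R p_pr).
Proof.
split.
- by apply/asboolP => e e0; exists 0%N => i _; rewrite padic_abs0.
- apply/asboolP => /(_ 1 ltr01)[N /(_ N (leqnn N))].
  by rewrite padic_abs1 // ltxx.
- move=> a u v /asboolP nu /asboolP nv; apply/asboolP.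
  have nz : padic_null R p (fun=> 0).
    by move=> e e0; exists 0%N => i _; rewrite padic_abs0.
  have := padic_nullB p_pr (padic_nullM p_pr (cauchy_valP a) nu)
    (padic_nullB p_pr nz nv).
  rewrite (_ : (fun i => _) = a * u + v :> (nat -> rat)) //.
  by apply/funext => i /=; rewrite sub0r opprK.
Qed.

HB.instance Definition _ R p (p_pr : prime p) :=
  isIdealr.Build _ (null_ideal R p_pr) (null_idealP R p_pr).

(* The field of p-adic numbers: the completion of [rat] for [padic_abs], that is
   Cauchy sequences modulo null sequences. [R] is the type of real numbers in
   which the norm takes its values. *)
Definition Qp (R : realType) (p : nat) (p_pr : prime p) : Type :=
  {ideal_quot (null_ideal R p_pr)}.


HB.instance Definition _ R p (p_pr : prime p) :=
  GRing.ComNzRing.copy (Qp R p_pr) {ideal_quot (null_ideal R p_pr)}.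

Section QpTheory.
Variables (R : realType) (p : nat) (p_pr : prime p).
Local Notation Qp := (Qp R p_pr).
Local Notation cauchy_seq := (cauchy_seq R p_pr).
Local Notation abs := (padic_abs R p).

Definition Qp_pi (u : cauchy_seq) : Qp :=
  \pi_({ideal_quot (null_ideal R p_pr)})%qT u.
Definition Qp_repr (x : Qp) : cauchy_seq :=
  repr (x : {ideal_quot (null_ideal R p_pr)}).

Lemma Qp_reprK x : Qp_pi (Qp_repr x) = x.
Proof. exact: reprK. Qed.

Lemma Qp_piP u v : reflect (Qp_pi u = Qp_pi v)
  `[< padic_null R p (fun i => u i - v i) >].
Proof.
have := Quotient.idealrBE (null_ideal R p_pr) u v.
rewrite -topredE /= /null_ideal => ->.
exact: eqP.
Qed.

Lemma Qp_pi0 : Qp_pi 0 = 0. Proof. exact: rmorph0. Qed.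
Lemma Qp_pi1 : Qp_pi 1 = 1. Proof. exact: rmorph1. Qed.
Lemma Qp_piD u v : Qp_pi (u + v) = Qp_pi u + Qp_pi v. Proof. exact: rmorphD. Qed.
Lemma Qp_piN u : Qp_pi (- u) = - Qp_pi u. Proof. exact: rmorphN. Qed.
Lemma Qp_piM u v : Qp_pi (u * v) = Qp_pi u * Qp_pi v. Proof. exact: rmorphM. Qed.

Fact Qp_inv_subproof (x : Qp) : exists y : Qp,
  if x == 0 then y = 0 else y * x = 1.
Proof.
have [_|x0] := eqVneq x 0; first by exists 0.
pose u := Qp_repr x.
have nu : ~ padic_null R p u.
  move=> nu; apply/negP: x0; rewrite negbK -(Qp_reprK x) -Qp_pi0; apply/eqP.
  apply/Qp_piP/asboolP => e /nu[N hN]; exists N => i /hN.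
  by rewrite /= subr0.
have [N [c [c0 hc]]] := padic_cauchy_const p_pr (cauchy_valP u) nu.
have ui0 i : (N <= i)%N -> u i != 0.
  by move=> Ni; rewrite -(padic_abs_eq0 R p_pr) hc // gt_eqF.
have cv : (fun i => (u i)^-1) \in cauchy_pred R p_pr.
  apply/asboolP => e e0; have ec0 : 0 < e * (c * c) by rewrite !mulr_gt0.
  have [M hM] := (asboolW (cauchy_valP u)) _ ec0.
  exists (maxn N M) => i j; rewrite !geq_max => /andP[Ni Mi] /andP[Nj Mj].
  rewrite (_ : _ - _ = (u j - u i) / (u i * u j)); last first.
    by field; rewrite !ui0.
  by rewrite padic_absM // padic_absV // padic_absM // !hc // ltr_pdivrMr
    ?mulr_gt0 // hM.
exists (Qp_pi (CauchySeq cv)).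
rewrite -{1}(Qp_reprK x) -Qp_piM -Qp_pi1; apply/Qp_piP/asboolP => e e0.
by exists N => i Ni /=; rewrite !fctE /= mulVf ?ui0 // subrr padic_abs0.
Qed.

Definition Qp_inv (x : Qp) : Qp := projT1 (cid (Qp_inv_subproof x)).

Fact Qp_mulVf (x : Qp) : x != 0 -> Qp_inv x * x = 1.
Proof. by rewrite /Qp_inv; case: cid => y /= + /negbTE x0; rewrite x0. Qed.

Fact Qp_invr0 : Qp_inv 0 = 0.
Proof. by rewrite /Qp_inv; case: cid => y /=; rewrite eqxx. Qed.

HB.instance Definition _ := GRing.ComNzRing_isField.Build Qp Qp_mulVf Qp_invr0.

Definition Qp_norm (x : Qp) : R := lim ((fun i => abs (Qp_repr x i)) @ \oo).

Lemma padic_null_cvg (u : nat -> rat) : padic_null R p u ->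
  (fun i => abs (u i)) @ \oo --> (0 : R).
Proof.
move=> nu; apply/cvgrPdist_lt => e /nu[N hN]; exists N => // i /= /hN.
by rewrite sub0r normrN ger0_norm // padic_abs_ge0.
Qed.

Lemma Qp_norm_cvg (u : cauchy_seq) :
  (fun i => abs (u i)) @ \oo --> Qp_norm (Qp_pi u).
Proof.
set w := Qp_repr (Qp_pi u).
have n1 : padic_null R p (fun i => w i - u i).
  by apply/asboolP/Qp_piP; rewrite Qp_reprK.
have cw : cvg ((fun i => abs (w i)) @ \oo).
  have [nw|nw] := pselect (padic_null R p w).
    by apply: cvgP (padic_null_cvg nw).
  have [N [c [c0 hc]]] := padic_cauchy_const p_pr (cauchy_valP w) nw.
  have h : (fun i => abs (w i)) @ \oo --> (c : R).
    by apply: cvg_near_cst; exists N.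
  exact: cvgP h.
have d0 : (fun i => abs (u i) - abs (w i)) @ \oo --> (0 : R).
  apply/cvgrPdist_le => e e0; have [N hN] := n1 e e0; exists N => // i /= Ni.
  rewrite sub0r normrN (le_trans _ (ltW (hN i Ni))) // ler_norml.
  have := padic_absD R p_pr (w i - u i) (u i).
  have := padic_absD R p_pr (u i - w i) (w i).
  by rewrite !subrK (padic_absB R p (u i)); lra.
have := cvgD d0 cw; rewrite add0r.
have -> : (fun i => abs (u i) - abs (w i)) + (fun i => abs (w i)) =
  (fun i => abs (u i)) by apply/funext => i; rewrite fctE subrK.
exact.
Qed.

Arguments Qp_norm_cvg : clear implicits.

Lemma Qp_normE (u : cauchy_seq) l : (fun i => abs (u i)) @ \oo --> (l : R) ->
  Qp_norm (Qp_pi u) = l.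
Proof. by move=> h; apply: cvg_unique h => //; exact: Qp_norm_cvg. Qed.

Lemma Qp_norm_ge0 x : 0 <= Qp_norm x.
Proof.
have h := Qp_norm_cvg (Qp_repr x); rewrite -(Qp_reprK x).
apply: (@ler_cvg_to _ _ _ _ (fun=> 0) _ _ _ (cvg_cst _) h).
by exists 0%N => // i _; exact: padic_abs_ge0.
Qed.

Lemma Qp_norm0 : Qp_norm 0 = 0.
Proof.
rewrite -Qp_pi0; apply: Qp_normE; apply: padic_null_cvg => e e0.
by exists 0%N => i _; rewrite padic_abs0.
Qed.

Lemma Qp_norm_eq0 x : Qp_norm x = 0 -> x = 0.
Proof.
move=> h; rewrite -(Qp_reprK x) -Qp_pi0; apply/Qp_piP/asboolP => e e0.
have := Qp_norm_cvg (Qp_repr x); rewrite Qp_reprK h.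
move=> /cvgrPdist_lt/(_ e e0)[N _ hN]; exists N => i /hN /=.
by rewrite sub0r normrN ger0_norm ?padic_abs_ge0 // subr0.
Qed.

Lemma Qp_normM x y : Qp_norm (x * y) = Qp_norm x * Qp_norm y.
Proof.
rewrite -(Qp_reprK x) -(Qp_reprK y) -Qp_piM; apply: Qp_normE.
have -> : (fun i => abs ((Qp_repr x * Qp_repr y) i)) =
    (fun i => abs (Qp_repr x i) * abs (Qp_repr y i)).
  by apply/funext => i; rewrite padic_absM.
by apply: cvgM; exact: Qp_norm_cvg.
Qed.

Lemma Qp_normN x : Qp_norm (- x) = Qp_norm x.
Proof.
rewrite -(Qp_reprK x) -Qp_piN; apply: Qp_normE.
have := Qp_norm_cvg (Qp_repr x).
by under eq_fun do rewrite -padic_absN.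
Qed.

Lemma Qp_norm_ultra x y :
  Qp_norm (x + y) <= Num.max (Qp_norm x) (Qp_norm y).
Proof.
rewrite -(Qp_reprK x) -(Qp_reprK y) -Qp_piD.
set u := Qp_repr x; set v := Qp_repr y.
have cm : (fun i => Num.max (abs (u i)) (abs (v i))) @ \oo -->
    Num.max (Qp_norm (Qp_pi u)) (Qp_norm (Qp_pi v)).
  rewrite maxr_absE; under eq_fun do rewrite maxr_absE.
  apply: cvgM; last exact: cvg_cst.
  apply: cvgD; first by apply: cvgD; exact: Qp_norm_cvg.
  by apply: cvg_norm; apply: cvgB; exact: Qp_norm_cvg.
apply: (ler_cvg_to (Qp_norm_cvg (u + v)) cm).
by exists 0%N => // i _; exact: padic_abs_ultra.
Qed.

Lemma Qp_normp : Qp_norm p%:R = p%:R^-1.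
Proof.
have E n : n%:R = Qp_pi n%:R :> Qp.
  by elim: n => [|n IH]; rewrite ?Qp_pi0 // -addn1 !natrD Qp_piD Qp_pi1 IH.
have F n i : (n%:R : cauchy_seq) i = n%:R.
  by elim: n => // n IH; rewrite -addn1 !natrD -IH.
rewrite E; apply: Qp_normE; apply: cvg_near_cst.
by exists 0%N => // i _ /=; rewrite F padic_absp.
Qed.

Definition Qp_dist (x y : Qp) : R := Qp_norm (x - y).

Fact Qp_distxx x : Qp_dist x x = 0.
Proof. by rewrite /Qp_dist subrr Qp_norm0. Qed.

Fact Qp_dist_eq0 x y : Qp_dist x y = 0 -> x = y.
Proof. by move/Qp_norm_eq0/eqP; rewrite subr_eq0 => /eqP. Qed.

Fact Qp_dist_sym x y : Qp_dist x y = Qp_dist y x.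
Proof. by rewrite /Qp_dist -Qp_normN opprB. Qed.

Fact Qp_dist_triangle y x z : Qp_dist x z <= Qp_dist x y + Qp_dist y z.
Proof.
rewrite /Qp_dist -[x - z](subrKA y) (le_trans (Qp_norm_ultra _ _)) //.
by rewrite ge_max lerDl lerDr !Qp_norm_ge0.
Qed.

(* A normedZmodType requires [`|x *+ n| = `|x| *+ n], which excludes
   nonarchimedean norms: only the metric structure is available. *)
HB.instance Definition _ := isMetric.Build R Qp
  Qp_distxx Qp_dist_eq0 Qp_dist_sym Qp_dist_triangle.

HB.instance Definition _ := isPointed.Build Qp 0.

End QpTheory.

Section Analytic.
Variables (R : realType) (p : nat) (p_pr : prime p).
Local Notation Qp := (Qp R p_pr).
Implicit Types (c : nat -> Qp) (f g h k : Qp -> Qp) (U : set Qp).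

(* A power series is given by its coefficients [c]. *)
Definition pseries_sum c (x : Qp) : nat -> Qp := series (fun n => c n * x ^+ n).

Definition conv_dom c : set Qp := [set x | cvg (pseries_sum c x @ \oo)].

Definition Qp_analytic c : Prop :=
  exists2 r : R, 0 < r & [set x | Qp_norm x < r] `<=` conv_dom c.

(* Meaningful on [conv_dom c] only. *)
Definition peval c (x : Qp) : Qp := lim (pseries_sum c x @ \oo).

(* c = X + a X^(m+1) + terms of higher degree *)
Definition tangent_to_id c (m : nat) (a : Qp) : Prop :=
  forall n, (n <= m.+1)%N ->
    c n = if n == 1%N then 1 else if n == m.+1 then a else 0.

Definition Zp_orbit f (x : Qp) : set Qp := closure (range (fun n => iter n f x)).

Definition same_Zp_orbit f U (x y : Qp) : Prop :=
  exists2 z, U z & Zp_orbit f z x /\ Zp_orbit f z y.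

(* [h] and [k] are only relevant on [U] and [V]. *)
Record homeomorphism (T : topologicalType) (U V : set T) (h k : T -> T) : Prop :=
  Homeomorphism {
    homeo_fun : set_fun U V h ;
    homeo_inv : set_fun V U k ;
    homeoK : {in U, cancel h k} ;
    homeoVK : {in V, cancel k h} ;
    homeo_cont : {within U, continuous h} ;
    homeo_contV : {within V, continuous k} }.

(* [k] is the inverse of the conjugating homeomorphism [h] *)
Record conjugacy (c d : nat -> Qp) (U1 U2 : set Qp) (h k : Qp -> Qp) : Prop :=
  Conjugacy {
    conj_nbhs1 : nbhs (0 : Qp) U1 ;
    conj_nbhs2 : nbhs (0 : Qp) U2 ;
    conj_dom1 : U1 `<=` conv_dom c ;
    conj_dom2 : U2 `<=` conv_dom d ;
    conj_stable1 : peval c @` U1 = U1 ;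
    conj_stable2 : peval d @` U2 = U2 ;
    conj_homeo : homeomorphism U1 U2 h k ;
    conj0 : h 0 = 0 ;
    conj_comm : forall x, U1 x -> h (peval c x) = peval d (h x) }.

End Analytic.

(* Main.v *)
(* On a small ball, the map [f] moves each point of a sphere [|x| = r] by
   [|a| r^(m+1)], and [f - id] is Lipschitz with a constant smaller than [1/p].
   This forces [|f^n x - x| = |n| |f x - x|] for every [n], so that by counting
   the [Z_p]-orbit of [x] is exactly the ball of radius [|a| r^(m+1)] around [x],
   on which [f] acts as [n -> n + 1] does on [Z_p].

   Hence the spheres of radius at least [q^l] contain about [p^(m l)] orbits of
   [f], and [p^(m' l)] orbits of [g], where [q = 1/p].  Enumerating the orbits
   of both maps by decreasing norm and matching those with the same index
   gives a conjugacy with [|h x|^m'] comparable to [|x|^m]; on each orbit it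
   extends [f^n x0 -> g^n y0] and is a similarity, whence the Hölder bounds.
   Conversely any conjugacy maps orbits injectively to orbits, and a larger
   exponent would inject about [p^(m' L)] orbits of [g] into fewer orbits of
   [f]. *)
Require Import Defs.
From mathcomp Require Import all_boot all_order all_algebra.
From mathcomp Require Import ring lra zify.
From mathcomp Require Import all_classical all_reals all_analysis.
Import Order.TTheory GRing.Theory Num.Theory.
Import numFieldNormedType.Exports.

Set Implicit Arguments.
Unset Strict Implicit.
Unset Printing Implicit Defensive.

Local Open Scope classical_set_scope.
Local Open Scope ring_scope.

(** * Arithmetic of the norm, completeness, residues modulo powers of [p], and topology in terms of
    the norm *)

Section PadicNorm.
Variables (R : realType) (p : nat) (p_pr : prime p).
Local Notation Qp := (Qp R p_pr).
Local Notation nrm := (@Qp_norm R p p_pr).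
Local Notation q := (p%:R^-1 : R).
Implicit Types x y z : Qp.

Lemma pV_gt0 : 0 < q.
Proof. by rewrite invr_gt0 ltr0n prime_gt0. Qed.

Lemma pV_lt1 : q < 1.
Proof. by rewrite invf_lt1 ?ltr0n ?prime_gt0 // ltr1n prime_gt1. Qed.

Lemma pVX_gt0 n : 0 < q ^+ n. Proof. by rewrite exprn_gt0 // pV_gt0. Qed.

Lemma pVX_le n k : (q ^+ n <= q ^+ k) = (k <= n)%N.
Proof. by rewrite ler_iXn2l // ?pV_gt0 ?pV_lt1. Qed.

Lemma pVX_lt n k : (q ^+ n < q ^+ k) = (k < n)%N.
Proof. by rewrite ltr_iXn2l // ?pV_gt0 ?pV_lt1. Qed.

Lemma pVX_inj n k : q ^+ n = q ^+ k -> n = k.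
Proof. by move=> h; apply/eqP; rewrite eqn_leq -!pVX_le h lexx. Qed.

Lemma pVX_small (e : R) : 0 < e -> exists n, q ^+ n < e.
Proof.
move=> e0; have : (fun n => q ^+ n) @ \oo --> (0 : R).
  by apply: cvg_expr; rewrite ger0_norm ?pV_lt1 // ltW // pV_gt0.
move=> /cvgrPdist_lt/(_ e e0)[N _ /(_ N (leqnn N))] /=.
by rewrite sub0r normrN ger0_norm ?(ltW (pVX_gt0 _)) //; exists N.
Qed.

Lemma Qp_norm_gt0 x : x != 0 -> 0 < nrm x.
Proof.
move=> x0; rewrite lt_neqAle Qp_norm_ge0 andbT eq_sym.
by apply: contraNneq x0 => /Qp_norm_eq0 ->.
Qed.

Lemma Qp_norm1 : nrm 1 = 1.
Proof.
have h : nrm 1 != 0 by rewrite gt_eqF // Qp_norm_gt0 // oner_eq0.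
by apply: (mulfI h); rewrite -Qp_normM !mulr1.
Qed.

Lemma Qp_normX x n : nrm (x ^+ n) = nrm x ^+ n.
Proof. by elim: n => [|n IH]; rewrite ?Qp_norm1 // !exprS Qp_normM IH. Qed.

Lemma Qp_normV x : nrm x^-1 = (nrm x)^-1.
Proof.
have [->|x0] := eqVneq x 0; first by rewrite invr0 Qp_norm0 invr0.
have h : nrm x != 0 by rewrite gt_eqF // Qp_norm_gt0.
by apply: (mulfI h); rewrite -Qp_normM !divff // Qp_norm1.
Qed.

Lemma Qp_normpX n : nrm (p%:R ^+ n) = q ^+ n.
Proof. by rewrite Qp_normX Qp_normp. Qed.

Lemma Qp_p_neq0 : p%:R != 0 :> Qp.
Proof.
apply/eqP => h; have := pV_gt0; rewrite -(Qp_normp R p_pr) h Qp_norm0.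
by rewrite ltxx.
Qed.

Lemma Qp_normB x y : nrm (x - y) = nrm (y - x).
Proof. by rewrite -Qp_normN opprB. Qed.

Lemma Qp_normD_le x y e : nrm x <= e -> nrm y <= e -> nrm (x + y) <= e.
Proof. by move=> h1 h2; rewrite (le_trans (Qp_norm_ultra _ _)) // ge_max h1. Qed.

Lemma Qp_normD_lt x y e : nrm x < e -> nrm y < e -> nrm (x + y) < e.
Proof.
by move=> h1 h2; rewrite (le_lt_trans (Qp_norm_ultra _ _)) // gt_max h1.
Qed.

Lemma Qp_dist_le y x z e : nrm (x - y) <= e -> nrm (y - z) <= e ->
  nrm (x - z) <= e.
Proof. by rewrite -[x - z](subrKA y); exact: Qp_normD_le. Qed.

Lemma Qp_dist_lt y x z e : nrm (x - y) < e -> nrm (y - z) < e ->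
  nrm (x - z) < e.
Proof. by rewrite -[x - z](subrKA y); exact: Qp_normD_lt. Qed.

Lemma Qp_norm_addl x y : nrm y < nrm x -> nrm (x + y) = nrm x.
Proof.
move=> h; apply/le_anti; rewrite Qp_normD_le ?(ltW h) //=.
rewrite leNgt; apply/negP => h'.
by have := Qp_normD_lt h' (_ : nrm (- y) < nrm x);
  rewrite Qp_normN addrK ltxx => /(_ h).
Qed.

Lemma Qp_norm_near x y : nrm (x - y) < nrm x -> nrm y = nrm x.
Proof.
rewrite Qp_normB => h; rewrite -{1}(subrKC x y); exact: Qp_norm_addl.
Qed.

Lemma Qp_norm_nat_le1 n : nrm n%:R <= 1.
Proof.
elim: n => [|n IH]; first by rewrite Qp_norm0.
by rewrite -addn1 natrD Qp_normD_le // Qp_norm1.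
Qed.

(** Powers of [p] factor out. For [k] prime to [p], a Bezout relation [u k = v p + 1] would give
    [|1| < 1] if [|k| < 1]. *)
Lemma Qp_norm_nat n : (0 < n)%N -> nrm n%:R = q ^+ logn p n.
Proof.
have coprime_norm k : coprime p k -> nrm k%:R = 1.
  move=> pk; have k0 : (0 < k)%N.
    case: k pk => //; rewrite /coprime gcdn0 => /eqP p1.
    by move: (prime_gt1 p_pr); rewrite p1.
  apply/le_anti; rewrite Qp_norm_nat_le1 /= leNgt; apply/negP => k1.
  case: (egcdnP p k0) => u v E _.
  move: pk; rewrite coprime_sym => /eqP pk; rewrite pk in E.
  have /eqP : (u * k)%N%:R - (v * p)%N%:R == 1 :> Qp.
    by rewrite E natrD addrC addKr.
  move=> E1; have := Qp_norm1; rewrite -E1 => E2.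
  have h1 : nrm (u * k)%N%:R < 1.
    rewrite natrM Qp_normM mulrC (le_lt_trans _ k1) // ler_piMr //.
      exact: Qp_norm_ge0.
    exact: Qp_norm_nat_le1.
  have h2 : nrm (- (v * p)%N%:R) < 1.
    rewrite Qp_normN natrM Qp_normM Qp_normp mulrC (le_lt_trans _ pV_lt1) //.
    by rewrite ler_piMr ?(ltW pV_gt0) // Qp_norm_nat_le1.
  by have := Qp_normD_lt h1 h2; rewrite E2 ltxx.
move=> n0; case: (pfactor_coprime p_pr n0) => k pk {1}->.
by rewrite natrM natrX Qp_normM Qp_normpX coprime_norm ?mul1r.
Qed.

Lemma Qp_norm_nat_dvd n k : (p ^ k %| n)%N -> nrm n%:R <= q ^+ k.
Proof.
case/dvdnP=> l ->; rewrite natrM natrX Qp_normM Qp_normpX.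
by rewrite ler_piMl ?(ltW (pVX_gt0 _)) // Qp_norm_nat_le1.
Qed.

Lemma Qp_norm_int (n : int) : nrm n%:~R = nrm `|n|%N%:R.
Proof. by case: n => n //; rewrite NegzE mulrNz Qp_normN. Qed.

Lemma Qp_norm_ratr (r : rat) : nrm (ratr r) = padic_abs R p r.
Proof.
rewrite /ratr Qp_normM Qp_normV !Qp_norm_int /padic_abs.
have [->|r0] := eqVneq r 0; first by rewrite Qp_norm0 mul0r.
rewrite !Qp_norm_nat ?absz_gt0 ?numq_eq0 ?denq_neq0 //.
by rewrite !exprVn invrK mulrC.
Qed.

Fact rat_cauchy_subproof (r : rat) : (fun=> r) \in cauchy_pred R p_pr.
Proof.
by apply/asboolP => e e0; exists 0%N => i j _ _; rewrite subrr padic_abs0.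
Qed.

Let cst (r : rat) := CauchySeq (rat_cauchy_subproof r).

Let cst_nat n : Qp_pi (cst n%:R) = n%:R.
Proof.
elim: n => [|n IH].
  transitivity (@Qp_pi R p p_pr 0); last exact: Qp_pi0.
  by congr Qp_pi; apply/val_inj/funext.
rewrite -addn1 !natrD -IH -Qp_pi1 -Qp_piD; congr Qp_pi.
exact/val_inj/funext.
Qed.

Let cst_int (n : int) : Qp_pi (cst n%:~R) = n%:~R.
Proof.
case: n => n; first exact: cst_nat.
rewrite NegzE !mulrNz -!pmulrn -cst_nat -Qp_piN; congr Qp_pi.
exact/val_inj/funext.
Qed.

Lemma Qp_natr_eq0 n : (n%:R == 0 :> Qp) = (n == 0%N).
Proof.
case: n => [|n]; first by rewrite !eqxx.
apply/negbTE/eqP => h; have := pVX_gt0 (logn p n.+1).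
by rewrite -Qp_norm_nat // h Qp_norm0 ltxx.
Qed.

Lemma Qp_intr_eq0 (n : int) : (n%:~R == 0 :> Qp) = (n == 0).
Proof.
case: n => n; first exact: Qp_natr_eq0.
by rewrite NegzE mulrNz oppr_eq0 -pmulrn Qp_natr_eq0.
Qed.

(** Identifies the class of a constant sequence with [ratr r], so that identities and limits
    involving [ratr] can be checked termwise on Cauchy sequences. *)
Let cstE r : Qp_pi (cst r) = ratr r.
Proof.
have d0 : (denq r)%:~R != 0 :> Qp by rewrite Qp_intr_eq0 denq_neq0.
apply: (mulIf d0); rewrite divfK // -!cst_int -Qp_piM; congr Qp_pi.
apply/val_inj/funext => i; change (r * (denq r)%:~R = (numq r)%:~R).
by rewrite numqE.
Qed.

Let ratrB_Qp r s : ratr r - ratr s = ratr (r - s) :> Qp.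
Proof.
by rewrite -!cstE -Qp_piN -Qp_piD; congr Qp_pi; apply/val_inj/funext.
Qed.

Let Qp_pi_dist (u : cauchy_seq R p_pr) e i :
  (exists N, forall j, (N <= j)%N -> padic_abs R p (u j - u i) < e) ->
  nrm (Qp_pi u - ratr (u i)) <= e.
Proof.
case=> N h; rewrite -cstE -Qp_piN -Qp_piD.
have h1 := @Qp_norm_cvg R p p_pr (u - cst (u i)).
apply: (@ler_cvg_to _ _ _ _ _ (fun=> e) _ _ h1 (cvg_cst _)).
by exists N => // j /= Nj; apply/ltW; exact: h.
Qed.

Lemma Qp_rat_dense x e : 0 < e -> exists r, nrm (x - ratr r) < e.
Proof.
move=> e0; have e20 : 0 < e / 2 by rewrite divr_gt0.
have [N hN] := asboolW (cauchy_valP (Qp_repr x)) _ e20.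
exists (Qp_repr x N); rewrite -{1}(Qp_reprK x).
apply: (@le_lt_trans _ _ (e / 2)); last by lra.
by apply: Qp_pi_dist; exists N => j Nj; exact: hN.
Qed.

(** Each [u n] is replaced by a rational [r n] at distance less than [q ^+ n]; the sequence [r] is
    Cauchy for [padic_abs], and its class is the limit. *)
Lemma Qp_complete (u : nat -> Qp) :
  (forall e, 0 < e -> exists N, forall i j, (N <= i)%N -> (N <= j)%N ->
     nrm (u i - u j) < e) ->
  exists l, forall e, 0 < e -> exists N, forall i, (N <= i)%N ->
     nrm (u i - l) < e.
Proof.
move=> cu.
have /choice[r hr] n : exists r, nrm (u n - ratr r) < q ^+ n.
  exact/Qp_rat_dense/pVX_gt0.
have close e : 0 < e -> exists N, forall n, (N <= n)%N ->
    nrm (u n - ratr (r n)) < e.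
  move=> /pVX_small[N hN]; exists N => n Nn.
  by rewrite (lt_trans (hr n)) // (le_lt_trans _ hN) // pVX_le.
have cr e : 0 < e -> exists N, forall i j, (N <= i)%N -> (N <= j)%N ->
    padic_abs R p (r i - r j) < e.
  move=> e0; have [N hN] := cu e e0; have [M hM] := close e e0.
  exists (maxn N M) => i j; rewrite !geq_max => /andP[Ni Mi] /andP[Nj Mj].
  rewrite -Qp_norm_ratr -ratrB_Qp.
  apply: (@Qp_dist_lt (u i)); first by rewrite Qp_normB hM.
  by apply: (@Qp_dist_lt (u j)); rewrite ?hM // hN.
have rc : r \in cauchy_pred R p_pr by apply/asboolP => e e0; exact: cr.
exists (Qp_pi (CauchySeq rc)) => e e0; have [N hN] := close e e0.
have e20 : 0 < e / 2 by rewrite divr_gt0.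
have [M hM] := cr _ e20; exists (maxn N M) => i.
rewrite geq_max => /andP[Ni Mi]; apply: (@Qp_dist_lt (ratr (r i))).
  exact: hN.
rewrite Qp_normB; apply: (@le_lt_trans _ _ (e / 2)); last by lra.
by apply: Qp_pi_dist; exists M => j Mj; exact: hM.
Qed.

(** A rational closer to [x] than [|x|] has the same norm. The factor [q ^+ k] allows for norms
    above 1 while keeping natural exponents. *)
Lemma Qp_norm_val x : x != 0 -> exists n k, nrm x * q ^+ k = q ^+ n.
Proof.
move=> x0; have [r hr] := Qp_rat_dense x (Qp_norm_gt0 x0).
rewrite -(Qp_norm_near hr) Qp_norm_ratr.
have r0 : r != 0.
  by apply: contraTneq hr => ->; rewrite /ratr mul0r subr0 ltxx.
exists (logn p `|numq r|), (logn p `|denq r|).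
rewrite /padic_abs (negbTE r0) !exprVn mulrAC divff ?mul1r //.
by rewrite expf_neq0 // pnatr_eq0 -lt0n prime_gt0.
Qed.

Lemma Qp_norm_le1_val x : x != 0 -> nrm x <= 1 -> exists n, nrm x = q ^+ n.
Proof.
move=> x0 x1; have [n [k h]] := Qp_norm_val x0.
have q0 := pVX_gt0 k.
exists (n - k)%N; apply: (mulIf (lt0r_neq0 q0)); rewrite h -exprD subnK //.
by rewrite -pVX_le -h ler_piMl // ltW.
Qed.

(** A rational [r] close to [x] also has norm at most 1, so its denominator is prime to [p]. With
    [u] inverse to this denominator modulo [p ^ n], the residue is [numq r * u] reduced modulo
    [p ^ n]. *)
Lemma Qp_residue x n : nrm x <= 1 ->
  exists2 r, (r < p ^ n)%N & nrm (x - r%:R) <= q ^+ n.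
Proof.
move=> x1; have pn0 : (0 < p ^ n)%N by rewrite expn_gt0 prime_gt0.
have [r hr] := Qp_rat_dense x (pVX_gt0 n).
have r1 : nrm (ratr r) <= 1.
  rewrite -[ratr r](subKr x) Qp_normD_le // Qp_normN (le_trans (ltW hr)) //.
  by rewrite -(expr0 q) pVX_le.
set b := `|denq r|%N.
have b0 : (0 < b)%N by rewrite absz_gt0 denq_neq0.
have cpb : coprime b (p ^ n).
  case: n {pn0 hr} => [|n]; first by rewrite coprimen1.
  rewrite coprime_pexpr // coprime_sym prime_coprime //.
  apply/negP => pb.
  have pa : ~~ (p %| `|numq r|)%N.
    apply: contraL (coprime_num_den r) => pa; apply/negP => /eqP c1.
    have : (p %| gcdn `|numq r| `|denq r|)%N by rewrite dvdn_gcd pa.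
    by rewrite c1 dvdn1 => /eqP p1; move: (prime_gt1 p_pr); rewrite p1.
  have a0 : (0 < `|numq r|)%N.
    by rewrite lt0n; apply: contraNneq pa => ->; rewrite dvdn0.
  move: r1; rewrite /ratr Qp_normM Qp_normV !Qp_norm_int !Qp_norm_nat //.
  rewrite lognE p_pr a0 (negbTE pa) expr0 mul1r invf_le1 ?pVX_gt0 //.
  rewrite -(expr0 q) pVX_le leqn0 => /eqP.
  by rewrite lognE p_pr b0 pb.
have [u v E _] := egcdnP (p ^ n) b0.
rewrite (eqP cpb) in E.
set N := p ^ n : nat in pn0 E *.
set s := ((numq r * u%:Z) %% N%:Z)%Z.
have N0 : N%:Z != 0 by rewrite eqz_nat -lt0n.
have s0 : 0 <= s by rewrite modz_ge0.
have sN : (`|s| < N)%N.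
  by rewrite -ltz_nat gez0_abs // ltz_pmod // ltz_nat.
exists `|s|%N => //; apply: (@Qp_dist_le (ratr r)); first exact: ltW.
apply: (@Qp_dist_le (numq r * u%:Z)%:~R).
  have -> : ratr r - (numq r * u%:Z)%:~R = - (ratr r * (v * N)%N%:R) :> Qp.
    have -> : (v * N)%N%:R = (u * b)%N%:R - 1 :> Qp by rewrite E natrD addrK.
    have -> : (u * b)%N%:R = u%:R * (denq r)%:~R :> Qp.
      rewrite natrM; congr (_ * _).
      by rewrite /b pmulrn gez0_abs // ltW // denq_gt0.
    rewrite mulrBr mulr1 opprB mulrCA; congr (_ - _).
    rewrite /ratr divfK ?Qp_intr_eq0 ?denq_neq0 // intrM mulrC.
    by rewrite -pmulrn.
  rewrite Qp_normN Qp_normM (le_trans (ler_wpM2r (Qp_norm_ge0 _) r1)) //.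
  by rewrite mul1r Qp_norm_nat_dvd // dvdn_mull.
have -> : (numq r * u%:Z)%:~R - `|s|%N%:R =
    ((numq r * u%:Z) %/ N%:Z)%Z%:~R * N%:R :> Qp.
  rewrite [`|s|%N%:R]pmulrn gez0_abs // {1}(divz_eq (numq r * u%:Z) N%:Z).
  by rewrite intrD intrM addrK -pmulrn.
rewrite Qp_normM Qp_norm_int -[leRHS]mul1r ler_pM ?Qp_norm_ge0 //.
  exact: Qp_norm_nat_le1.
exact: Qp_norm_nat_dvd.
Qed.

Lemma Qp_residue_inj n r s : (r < p ^ n)%N -> (s < p ^ n)%N ->
  nrm (r%:R - s%:R) <= q ^+ n -> r = s.
Proof.
wlog rs : r s / (r <= s)%N => [H|] hr hs h.
  have [rs|/ltnW sr] := leqP r s; first exact: H.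
  by apply/esym/H => //; rewrite Qp_normB.
move: rs; rewrite leq_eqVlt => /predU1P[//|rs].
move: h; rewrite Qp_normB -natrB ?(ltnW rs) // Qp_norm_nat ?subn_gt0 //.
rewrite pVX_le => h.
have : (p ^ n <= s - r)%N.
  by rewrite dvdn_leq ?subn_gt0 // pfactor_dvdn ?subn_gt0.
by lia.
Qed.

Lemma Qp_nbhsP x (U : set Qp) :
  nbhs x U <-> exists2 e, 0 < e & forall y, nrm (y - x) < e -> U y.
Proof.
split=> [/nbhs_ballP[e /= e0 h]|[e e0 h]].
  exists e => // y hy; apply: h; rewrite ballEmdist.
  by change (nrm (x - y) < e); rewrite Qp_normB.
apply/nbhs_ballP; exists e => //= y.
by rewrite ballEmdist => xy; apply: h; rewrite Qp_normB.
Qed.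

Lemma Qp_cvgP (u : nat -> Qp) l : u @ \oo --> l <->
  forall e, 0 < e -> exists N, forall i, (N <= i)%N -> nrm (u i - l) < e.
Proof.
split=> [ul e e0|h U /Qp_nbhsP[e e0 eU]].
  have /ul[N _ hN] : nbhs l [set y | nrm (y - l) < e].
    by apply/Qp_nbhsP; exists e.
  by exists N => i /hN.
by have [N hN] := h e e0; exists N => // i /hN /eU.
Qed.

Lemma Qp_closureP (A : set Qp) x :
  closure A x <-> forall e, 0 < e -> exists2 y, A y & nrm (y - x) < e.
Proof.
split=> [cA e e0|h U /Qp_nbhsP[e e0 eU]].
  have /cA[y [Ay yx]] : nbhs x [set y | nrm (y - x) < e].
    by apply/Qp_nbhsP; exists e.
  by exists y.
by have [y Ay /eU Uy] := h e e0; exists y.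
Qed.

Lemma Qp_continuous_withinP (U : set Qp) (h : Qp -> Qp) :
  {within U, continuous h} <->
  forall x, U x -> forall e, 0 < e -> exists2 d, 0 < d &
    forall y, U y -> nrm (y - x) < d -> nrm (h y - h x) < e.
Proof.
split=> [/subspace_continuousP ch x Ux e e0|H].
  have /(ch x Ux)/Qp_nbhsP[d d0 hd] : nbhs (h x) [set y | nrm (y - h x) < e].
    by apply/Qp_nbhsP; exists e.
  by exists d => // y Uy /hd /(_ Uy).
apply/subspace_continuousP => x Ux V /Qp_nbhsP[e e0 eV].
have [d d0 hd] := H x Ux e e0; apply/Qp_nbhsP; exists d => // y yx Uy.
exact/eV/hd.
Qed.

End PadicNorm.

(** * Iteration of maps that differ from the identity by a strong contraction *)

Section NearIdentity.
Variables (R : realType) (p : nat) (p_pr : prime p).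
Local Notation Qp := (Qp R p_pr).
Local Notation nrm := (@Qp_norm R p p_pr).
Local Notation q := (p%:R^-1 : R).
Implicit Types (x y z : Qp) (F : Qp -> Qp).

Definition near_id (rho th : R) F : Prop :=
  (forall x, nrm x <= rho -> nrm (F x) <= rho) /\
  (forall x y, nrm x <= rho -> nrm y <= rho ->
     nrm ((F x - x) - (F y - y)) <= th * nrm (x - y)).

Variables (rho th : R) (rho0 : 0 < rho) (th0 : 0 <= th) (thq : th < q).

Lemma near_id_isom F x y : near_id rho th F -> nrm x <= rho -> nrm y <= rho ->
  nrm (F x - F y) = nrm (x - y).
Proof.
move=> [_ lip] bx bey; have [->|xy] := eqVneq x y; first by rewrite !subrr.
rewrite (_ : F x - F y = (x - y) + ((F x - x) - (F y - y))); last by ring.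
rewrite Qp_norm_addl // (le_lt_trans (lip x y bx bey)) // gtr_pMl //.
  exact: lt_trans thq (pV_lt1 R p_pr).
by rewrite Qp_norm_gt0 // subr_eq0.
Qed.

(** The constant [th] does not grow with [n]: the increments of [F] along two orbits differ by at
    most [th * |x - y|], since iterates are isometries, and the ultrametric inequality does not
    accumulate these errors. *)
Lemma near_id_iter F n : near_id rho th F -> near_id rho th (iter n F).
Proof.
move=> nF; have [stab lip] := nF; elim: n => [|n [stabn lipn]].
  split=> // x y _ _ /=; rewrite !subrr Qp_norm0.
  by rewrite mulr_ge0 // Qp_norm_ge0.
split=> [x bx|x y bx bey] /=; first exact/stab/stabn.
rewrite (_ : _ - _ = ((F (iter n F x) - iter n F x)
    - (F (iter n F y) - iter n F y))
  + ((iter n F x - x) - (iter n F y - y))); last by ring.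
apply: Qp_normD_le; last exact: lipn.
rewrite -(@near_id_isom (iter n F) x y) //.
by apply: lip; exact: stabn.
Qed.

Lemma near_id_iter_le F n x : near_id rho th F -> nrm x <= rho ->
  nrm (iter n F x - x) <= nrm (F x - x).
Proof.
move=> nF bx; elim: n => [|n IH] /=; first by rewrite subrr Qp_norm0 Qp_norm_ge0.
apply: (@Qp_dist_le _ _ _ (F x)) => //.
by rewrite (near_id_isom nF) //; apply: (near_id_iter n nF).1.
Qed.

(** Each of the [n] increments along the orbit is [F x - x] up to [th * |F x - x|], because the
    orbit stays within [|F x - x|] of [x]. *)
Lemma near_id_iter_err F n x : near_id rho th F -> nrm x <= rho ->
  nrm (iter n F x - x - n%:R * (F x - x)) <= th * nrm (F x - x).
Proof.
move=> nF bx; elim: n => [|n IH] /=.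
  by rewrite subrr mul0r subrr Qp_norm0 mulr_ge0 // Qp_norm_ge0.
rewrite (_ : _ - _ = (iter n F x - x - n%:R * (F x - x))
   + ((F (iter n F x) - iter n F x) - (F x - x))); last first.
  by rewrite -[n.+1]addn1 natrD; ring.
apply: Qp_normD_le => //.
apply: le_trans (nF.2 _ _ _ bx) _; first exact: (near_id_iter n nF).1.
exact/ler_wpM2l/near_id_iter_le.
Qed.

(* Writing [n = p n'] reduces to the iterate [F^p], which satisfies the same
   Lipschitz condition, so that the error term never exceeds [|F x - x| / p]. *)
Lemma near_id_iter_norm F n x : near_id rho th F -> nrm x <= rho ->
  nrm (iter n F x - x) = nrm n%:R * nrm (F x - x).
Proof.
elim/ltn_ind: n F => n IH F nF bx.
have [Fx|Fx] := eqVneq (F x - x) 0.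
  rewrite Fx Qp_norm0 mulr0; apply/le_anti; rewrite Qp_norm_ge0 andbT.
  by rewrite -(Qp_norm0 R p_pr) -Fx near_id_iter_le.
have d0 := Qp_norm_gt0 Fx.
have small k : q <= nrm k%:R ->
    nrm (iter k F x - x) = nrm k%:R * nrm (F x - x).
  move=> kq; rewrite -Qp_normM -[iter k F x - x](subrKC (k%:R * (F x - x))).
  rewrite Qp_norm_addl // (le_lt_trans (near_id_iter_err _ nF bx)) //.
  by rewrite Qp_normM ltr_pM2r // (lt_le_trans thq).
have [pn|pn] := boolP (p %| n)%N; last first.
  apply: small; have n0 : (0 < n)%N by rewrite lt0n; apply: contraNneq pn => ->.
  by rewrite Qp_norm_nat // lognE p_pr n0 (negbTE pn) ltW // pV_lt1.
have [n0|n0] := posnP n; first by rewrite n0 /= subrr Qp_norm0 mul0r.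
case/dvdnP: pn n0 IH => k -> n0 IH.
have k0 : (0 < k)%N by move: n0; rewrite muln_gt0 => /andP[].
rewrite iterM IH //; first last.
- exact: near_id_iter.
- by rewrite -[ltnLHS]muln1 ltn_pmul2l // prime_gt1.
by rewrite natrM Qp_normM -mulrA small // Qp_normp.
Qed.

Lemma near_id_iter_dist F n k x : near_id rho th F -> nrm x <= rho ->
  nrm (iter n F x - iter k F x) = nrm (n%:R - k%:R) * nrm (F x - x).
Proof.
move=> nF bx; wlog kn : n k / (k <= n)%N => [H|].
  have [kn|/ltnW nk] := leqP k n; first exact: H.
  by rewrite Qp_normB [nrm (_%:R - _)]Qp_normB; exact: H.
rewrite -{1}(subnKC kn) iterD (near_id_isom (near_id_iter k nF)) //; last first.
  exact: (near_id_iter (n - k) nF).1.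
by rewrite (near_id_iter_norm _ nF bx) natrB.
Qed.

(* The [p^j] first iterates are pairwise far apart, hence they meet each of the
   [p^j] balls of radius [q^j |F x - x|] in the ball of radius [|F x - x|]. *)
Lemma near_id_orbit_dense F x y j : near_id rho th F -> nrm x <= rho ->
  nrm (y - x) <= nrm (F x - x) ->
  exists n, nrm (iter n F x - y) <= q ^+ j * nrm (F x - x).
Proof.
move=> nF bx yx; have [Fx|Fx] := eqVneq (F x - x) 0.
  exists 0%N; rewrite /= Qp_normB Fx Qp_norm0 mulr0.
  by rewrite -(Qp_norm0 R p_pr) -Fx.
set d := F x - x in Fx yx *.
have d0 : 0 < nrm d := Qp_norm_gt0 Fx.
have res z : nrm (z - x) <= nrm d ->
    exists r : 'I_(p ^ j), nrm ((z - x) / d - r%:R) <= q ^+ j.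
  move=> zx; have : nrm ((z - x) / d) <= 1.
    by rewrite Qp_normM Qp_normV ler_pdivrMr // mul1r.
  by case/(Qp_residue j) => r rj h; exists (Ordinal rj).
have /choice[r hr] (n : 'I_(p ^ j)) : exists r : 'I_(p ^ j),
    nrm ((iter n F x - x) / d - r%:R) <= q ^+ j.
  exact/res/near_id_iter_le.
have close z w (s : 'I_(p ^ j)) : nrm ((z - x) / d - s%:R) <= q ^+ j ->
    nrm ((w - x) / d - s%:R) <= q ^+ j -> nrm (z - w) <= q ^+ j * nrm d.
  move=> hz hw; rewrite Qp_normB in hw; have := Qp_dist_le hz hw.
  rewrite -mulrBl opprB subrKA Qp_normM Qp_normV.
  by rewrite ler_pdivrMr.
have inj_r : injective r.
  move=> n k rnk; have := hr k; rewrite -rnk => /(close _ _ _ (hr n)).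
  rewrite near_id_iter_dist // ler_pM2r // => h.
  exact/val_inj/(Qp_residue_inj (ltn_ord n) (ltn_ord k) h).
have [s hs] := res y yx; have [g rK gK] := injF_bij inj_r.
exists (g s); apply: close (hr (g s)) _.
by rewrite gK.
Qed.

(** Since [F^(p^j) y] tends to [y] and [F] is an isometry, the points [F^(p^j - 1) y] form a Cauchy
    sequence; its limit is a preimage of [y]. *)
Lemma near_id_surj F y : near_id rho th F -> nrm y <= rho ->
  exists2 x, nrm x <= rho & F x = y.
Proof.
move=> nF bey; set d := nrm (F y - y).
have stab n x : nrm x <= rho -> nrm (iter n F x) <= rho.
  exact: (near_id_iter n nF).1.
have ret j : nrm (iter (p ^ j) F y - y) = q ^+ j * d.
  by rewrite (near_id_iter_norm _ nF bey) natrX Qp_normpX.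
pose z j := iter (p ^ j).-1 F y.
have Fz j : F (z j) = iter (p ^ j) F y.
  by rewrite /z -iterS prednK // expn_gt0 prime_gt0.
have small e : 0 < e -> exists N, forall j, (N <= j)%N ->
    nrm (iter (p ^ j) F y - y) < e.
  move=> e0; have [d0|d0] := eqVneq d 0.
    by exists 0%N => j _; rewrite ret d0 mulr0.
  have dp : 0 < d by rewrite lt_neqAle eq_sym d0 /= Qp_norm_ge0.
  have [N hN] := pVX_small p_pr (divr_gt0 e0 dp); exists N => j Nj.
  rewrite ret -ltr_pdivlMr // (le_lt_trans _ hN) //.
  by rewrite pVX_le.
have [x hx] : exists l, forall e, 0 < e -> exists N, forall i, (N <= i)%N ->
     nrm (z i - l) < e.
  apply: Qp_complete => e /small[N hN]; exists N => i j Ni Nj.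
  have E : nrm (F (z i) - F (z j)) = nrm (z i - z j).
    by apply: (near_id_isom nF); exact: stab.
  rewrite -E !Fz; apply: (@Qp_dist_lt _ _ _ y); first exact: hN.
  by rewrite Qp_normB; exact: hN.
have bx : nrm x <= rho.
  have [N hN] := hx _ rho0; rewrite -[x](subKr (z N)).
  by apply: Qp_normD_le; [exact: stab|rewrite Qp_normN ltW // hN].
exists x => //; apply/eqP; rewrite -subr_eq0; apply/negPn/negP => Fxy.
have e0 := Qp_norm_gt0 Fxy.
have [N hN] := hx _ e0; have [M hM] := small _ e0.
have h1 : nrm (F x - F (z (maxn N M))) < nrm (F x - y).
  rewrite (near_id_isom nF) //; last exact: stab.
  by rewrite Qp_normB hN // leq_maxl.
have h2 : nrm (F (z (maxn N M)) - y) < nrm (F x - y).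
  by rewrite Fz hM // leq_maxr.
by have := Qp_dist_lt h1 h2; rewrite ltxx.
Qed.

End NearIdentity.

(** * From a power series tangent to the identity to its displacement on small spheres *)

Section Germ.
Variables (R : realType) (p : nat) (p_pr : prime p).
Local Notation Qp := (Qp R p_pr).
Local Notation nrm := (@Qp_norm R p p_pr).
Local Notation q := (p%:R^-1 : R).
Implicit Types (x y z : Qp) (F : Qp -> Qp) (c : nat -> Qp).

(* On the sphere of radius [q ^+ (i0 + l)], the displacement [F x - x] has
   constant norm [|a| |x| ^+ m.+1], so that [K] stands for the valuation of
   [a * p ^+ (m * i0)]. *)
Record germ (m i0 K : nat) F : Prop := Germ {
  germ_m : (0 < m)%N ;
  germ_K : (0 < K)%N ;
  germ0 : F 0 = 0 ;
  germ_lip : exists th, [/\ 0 <= th, th < q & forall x y,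
    nrm x <= q ^+ i0 -> nrm y <= q ^+ i0 ->
    nrm ((F x - x) - (F y - y)) <= th * nrm (x - y)] ;
  germ_norm : forall l x, nrm x = q ^+ (i0 + l) ->
    nrm (F x - x) = q ^+ (i0 + l + (m * l + K)) }.

Lemma subrBACA (V : zmodType) (a b c d : V) :
  a - b - (c - d) = a - c - (b - d).
Proof. by rewrite !opprD !opprK addrACA. Qed.

Lemma Qp_cvg_dist_le (u : nat -> Qp) (l v : Qp) e N : u @ \oo --> l ->
  (forall n, (N <= n)%N -> nrm (u n - v) <= e) -> nrm (l - v) <= e.
Proof.
move=> /Qp_cvgP ul h; rewrite leNgt; apply/negP => lv.
have e0 : 0 <= e := le_trans (Qp_norm_ge0 _) (h N (leqnn N)).
have [M hM] := ul _ (le_lt_trans e0 lv).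
have := hM (maxn N M) (leq_maxr _ _).
rewrite [X in X < _]Qp_normB => h1.
have := Qp_dist_lt h1 (le_lt_trans (h _ (leq_maxl N M)) lv).
by rewrite ltxx.
Qed.

Lemma Qp_cvgB (u v : nat -> Qp) (l k : Qp) : u @ \oo --> l -> v @ \oo --> k ->
  (fun n => u n - v n) @ \oo --> l - k.
Proof.
move=> /Qp_cvgP ul /Qp_cvgP vk; apply/Qp_cvgP => e e0.
have [N hN] := ul e e0; have [M hM] := vk e e0.
exists (maxn N M) => n; rewrite geq_max subrBACA => /andP[/hN h1 /hM h2].
by apply: Qp_normD_lt => //; rewrite Qp_normN.
Qed.

Lemma Qp_norm_sum_le (t : nat -> Qp) e n : 0 <= e ->
  (forall k, nrm (t k) <= e) -> nrm (\sum_(0 <= k < n) t k) <= e.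
Proof.
move=> e0 h; elim: n => [|n IH]; first by rewrite big_geq // Qp_norm0.
by rewrite big_nat_recr //= Qp_normD_le.
Qed.

Lemma Qp_norm_subrX x y s n : nrm x <= s -> nrm y <= s ->
  nrm (x ^+ n - y ^+ n) <= s ^+ n.-1 * nrm (x - y).
Proof.
move=> xs ys; have s0 := le_trans (Qp_norm_ge0 x) xs.
rewrite subrXX Qp_normM mulrC ler_wpM2r ?Qp_norm_ge0 //.
have e0 : 0 <= s ^+ n.-1 by rewrite exprn_ge0.
apply: (big_ind (fun z => nrm z <= s ^+ n.-1)) => [|z w|i _].
- by rewrite Qp_norm0.
- exact: Qp_normD_le.
rewrite Qp_normM !Qp_normX.
have -> : n.-1 = (n.-1 - i + i)%N by have := ltn_ord i; lia.
by rewrite exprD addnK ler_pM ?exprn_ge0 ?Qp_norm_ge0 ?lerXn2r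
  ?nnegrE ?Qp_norm_ge0.
Qed.

(** Puts a monomial over the same index range as a partial sum, so that subtracting it only changes
    one coefficient. *)
Lemma sum_monomial (b x : Qp) j n : (j < n)%N ->
  \sum_(0 <= k < n) (k == j)%:R * b * x ^+ k = b * x ^+ j.
Proof.
move=> jn; rewrite (bigD1_seq j) ?mem_index_iota ?iota_uniq //= eqxx mul1r.
by rewrite big1 ?addr0 // => k /negbTE ->; rewrite !mul0r.
Qed.

(** The terms of a series converging at [p ^ N] are bounded, and the bound is absorbed into a power
    [q ^- b]. *)
Lemma conv_coef_bound c N : conv_dom c (p%:R ^+ N) ->
  exists b, forall n, nrm (c n) * q ^+ (N * n + b) <= 1.
Proof.
move=> /Qp_cvgP/(_ 1 ltr01)[M hM].
have [B hB] : exists B, forall n, nrm (c n) * q ^+ (N * n) <= B.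
  have tail n : (M <= n)%N -> nrm (c n) * q ^+ (N * n) <= 1.
    move=> Mn; rewrite exprM -Qp_normpX -Qp_normX -Qp_normM.
    rewrite (_ : _ * _ = pseries_sum c (p%:R ^+ N) n.+1
                       - pseries_sum c (p%:R ^+ N) n); last first.
      by rewrite /pseries_sum /series /= big_nat_recr //= addrAC subrr add0r.
    rewrite -[X in nrm X](subrKA (peval c (p%:R ^+ N))).
    apply: Qp_normD_le; first exact/ltW/hM/leqW.
    by rewrite Qp_normB; apply/ltW/hM.
  exists (1 + \sum_(k < M) nrm (c k) * q ^+ (N * k)) => n.
  have pos k : 0 <= nrm (c k) * q ^+ (N * k).
    by rewrite mulr_ge0 ?Qp_norm_ge0 ?(ltW (pVX_gt0 _ p_pr _)).
  have [nM|Mn] := ltnP n M.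
    rewrite (bigD1 (Ordinal nM)) //= addrCA lerDl addr_ge0 //.
    exact: sumr_ge0.
  by rewrite (le_trans (tail n Mn)) // lerDl sumr_ge0.
have B0 : 0 < 1 + `|B| by rewrite ltr_pwDl.
have [b hb] := pVX_small p_pr (divr_gt0 ltr01 B0).
exists b => n; rewrite exprD mulrA.
apply: (@le_trans _ _ ((1 + `|B|) * q ^+ b)).
  rewrite ler_wpM2r ?(ltW (pVX_gt0 _ p_pr _)) // (le_trans (hB n)) //.
  by rewrite (le_trans (ler_norm B)) // lerDr.
by move: hb; rewrite ltr_pdivlMr // mulrC => /ltW.
Qed.

(** On a small enough ball the term [a X^(m+1)] strictly dominates all later terms of the series
    minus [X], and every term of degree at least 2 is Lipschitz with constant at most [q ^+ 2]. *)
Lemma analytic_germ c m a e : Qp_analytic c -> (0 < m)%N -> a <> 0 ->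
  tangent_to_id c m a -> 0 < e ->
  exists i0 K, [/\ q ^+ i0 < e, germ m i0 K (peval c) &
    forall x, nrm x <= q ^+ i0 -> conv_dom c x].
Proof.
move=> [r r0 conv] m0 /eqP a0 cE e0.
have [N hN] := pVX_small p_pr r0; have [E hE] := pVX_small p_pr e0.
have cN : conv_dom c (p%:R ^+ N) by apply: conv; rewrite /= Qp_normpX.
have [b hb] := conv_coef_bound cN.
have [A [B aE]] := Qp_norm_val a0.
(* A crude margin: [N] and [b] control the coefficients, [A - B] is the valuation of [a], [E]
   enforces the bound [e], and [2] the Lipschitz constant [q ^+ 2]. The multiple [N * m.+1] leaves
   room to compare a term of degree above [m.+1] with the one of degree [m.+1]. *)
pose t := (N * m.+1 + b + A + B + E + 2)%N; pose i0 := (N + t)%N.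
have coef_le n k j : (N * n + b + j <= k)%N -> nrm (c n) * q ^+ k <= q ^+ j.
  move=> h; have := hb n; rewrite -(ler_pM2r (pVX_gt0 R p_pr j)) mul1r.
  apply: le_trans; rewrite -mulrA -exprD ler_wpM2l ?Qp_norm_ge0 //.
  by rewrite pVX_le.
have cvx x : nrm x <= q ^+ i0 -> conv_dom c x.
  move=> xi; apply: conv => /=; rewrite (le_lt_trans xi) //.
  by rewrite (le_lt_trans _ hN) // pVX_le // /i0 leq_addr.
have pow0 n : 0 <= q ^+ n := ltW (pVX_gt0 R p_pr n).
have id1 n x : (1 < n)%N -> x = \sum_(0 <= k < n) (k == 1%N)%:R * 1 * x ^+ k.
  by move=> n1; rewrite sum_monomial // mul1r expr1.
(* The valuation of [a * p ^+ (m * i0)]; the bound [B < m * i0] below makes the truncated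
   subtraction exact and the result positive. *)
exists i0, (A + (m * i0 - B))%N; split=> //.
  by rewrite (le_lt_trans _ hE) // pVX_le // /i0 /t; lia.
have B_le : (B < m * i0)%N.
  by rewrite (@leq_trans i0) ?leq_pmull // /i0 /t; lia.
split=> //.
- by rewrite addn_gt0 subn_gt0 B_le orbT.
- apply: Qp_norm_eq0; apply/le_anti; rewrite Qp_norm_ge0 andbT.
  rewrite -[peval c 0]subr0; apply: (@Qp_cvg_dist_le _ _ _ _ 0) (cvx 0 _) _.
    by rewrite Qp_norm0.
  move=> n _; rewrite subr0 /pseries_sum /series /= Qp_norm_sum_le // => k.
  rewrite expr0n; case: k => [|k]; last by rewrite mulr0 Qp_norm0.
  by rewrite cE // mul0r Qp_norm0.
- exists (q ^+ 2); split=> // [|x y xi yi].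
    by rewrite -[ltRHS]expr1 pVX_lt.
  rewrite subrBACA.
  have cD : (fun n => pseries_sum c x n - pseries_sum c y n) @ \oo -->
      peval c x - peval c y.
    exact: Qp_cvgB (cvx x xi) (cvx y yi).
  apply: (@Qp_cvg_dist_le _ _ _ _ 2) cD _ => n n2.
  have -> : pseries_sum c x n - pseries_sum c y n - (x - y) =
      \sum_(0 <= k < n) (c k - (k == 1%N)%:R) * (x ^+ k - y ^+ k).
    rewrite [X in _ - (X - _)](id1 n) // [X in _ - (_ - X)](id1 n) //.
    rewrite /pseries_sum /series /= -!sumrB; apply: eq_bigr => k _; ring.
  have dxy := Qp_norm_ge0 (x - y).
  apply: Qp_norm_sum_le => [|k]; first by rewrite mulr_ge0.
  rewrite Qp_normM (le_trans (ler_wpM2l (Qp_norm_ge0 _)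
    (Qp_norm_subrX k xi yi))) //.
  rewrite mulrA ler_wpM2r //.
  case: k => [|[|k]]; [by rewrite cE // subrr Qp_norm0 mul0r..|].
  rewrite subr0 -exprM; apply: coef_le; rewrite /i0 /t; nia.
- move=> l x xl; have xi : nrm x <= q ^+ i0 by rewrite xl pVX_le // leq_addr.
  have aK : nrm (a * x ^+ m.+1) = q ^+ (i0 + l + (m * l + (A + (m * i0 - B)))).
    rewrite Qp_normM Qp_normX xl -exprM.
    apply: (mulIf (lt0r_neq0 (pVX_gt0 R p_pr B))).
    rewrite mulrAC aE -!exprD; congr (_ ^+ _); nia.
  rewrite -[peval c x - x](subrKC (a * x ^+ m.+1)) Qp_norm_addl aK //.
  rewrite -addrA -opprD.
  (* Since [|a| >= q ^+ A], this bound is smaller than [|a x^(m+1)|] by at least a factor [p]. *)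
  apply: (@le_lt_trans _ _ (q ^+ (A + 1 + (i0 + l) * m.+1))); last first.
    by rewrite pVX_lt //; nia.
  apply: (@Qp_cvg_dist_le _ _ _ _ m.+2) (cvx x xi) _ => n nm.
  have -> : pseries_sum c x n - (x + a * x ^+ m.+1) =
    \sum_(0 <= k < n) (c k - (k == 1%N)%:R * 1 - (k == m.+1)%:R * a) * x ^+ k.
    rewrite [X in _ - (X + _)](id1 n) ?(leq_trans _ nm) //.
    rewrite -(@sum_monomial _ _ _ n) // opprD addrA.
    rewrite /pseries_sum /series /= -!sumrB; apply: eq_bigr => k _; ring.
  apply: Qp_norm_sum_le => // k.
  have [km|km] := leqP k m.+1.
    rewrite cE //; have [->|k1] := eqVneq k 1%N.
      by rewrite eqSS eq_sym gtn_eqF // mul1r mul0r subr0 subrr mul0r Qp_norm0.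
    rewrite mul0r subr0; case: eqVneq => _.
      by rewrite mul1r subrr mul0r Qp_norm0.
    by rewrite mul0r subr0 mul0r Qp_norm0.
  rewrite !gtn_eqF // ?(leq_trans _ km) // !mul0r !subr0 Qp_normM Qp_normX xl.
  rewrite -exprM.
  have -> : ((i0 + l) * k = (i0 + l) * (k - m.+1) + (i0 + l) * m.+1)%N.
    by rewrite -mulnDr subnK // ltnW.
  rewrite !exprD !mulrA ler_wpM2r // -exprD.
  by apply: coef_le; rewrite /i0 /t; nia.
Qed.

End Germ.

(** * Locating an integer between consecutive values of an increasing sequence *)

Section Intervals.
Local Open Scope nat_scope.
Variables (S : nat -> nat) (S0 : S 0 = 0) (Slt : forall l, S l < S l.+1).

Lemma incr_step_lt l k : S l < S k -> l < k.
Proof.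
apply: contraTltn => kl; rewrite -leqNgt.
elim: l kl => [|l IH]; first by rewrite leqn0 => /eqP ->.
rewrite leq_eqVlt => /predU1P[->//|/IH kl].
exact: leq_trans kl (ltnW (Slt l)).
Qed.

Lemma incr_step_find n : exists l, S l <= n < S l.+1.
Proof.
elim: n => [|n [l /andP[ln nl]]]; first by exists 0; have := Slt 0; rewrite S0.
move: nl; rewrite leq_eqVlt => /predU1P[nl|nl].
  by exists l.+1; rewrite nl leqnn Slt.
by exists l; rewrite nl andbT (leq_trans ln).
Qed.

Lemma incr_step_uniq n l k : S l <= n < S l.+1 -> S k <= n < S k.+1 -> l = k.
Proof.
move=> /andP[ln nl] /andP[kn nk]; apply/eqP; rewrite eqn_leq.
have lk : S l < S k.+1 by apply: leq_ltn_trans ln nk.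
have kl : S k < S l.+1 by apply: leq_ltn_trans kn nl.
by have := incr_step_lt lk; have := incr_step_lt kl; rewrite !ltnS => -> ->.
Qed.

End Intervals.

(** * Counting the orbits on spheres of decreasing radius *)

Section OrbitsBelow.
Local Open Scope nat_scope.
Variables (p m K : nat) (p2 : 1 < p) (m0 : 0 < m) (K0 : 0 < K).

(* The sphere of radius [q ^+ (i0 + l)] consists of [p.-1 * p ^ (m * l + K).-1]
   orbits. *)
Definition orbits_below l := \sum_(k < l) p.-1 * p ^ (m * k + K).-1.

Let p0 : 0 < p := ltnW p2.

Lemma orbits_below0 : orbits_below 0 = 0.
Proof. by rewrite /orbits_below big_ord0. Qed.

Lemma orbits_belowS l :
  orbits_below l.+1 = orbits_below l + p.-1 * p ^ (m * l + K).-1.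
Proof. by rewrite /orbits_below big_ord_recr. Qed.

Lemma orbits_below_lt l : orbits_below l < orbits_below l.+1.
Proof.
by rewrite orbits_belowS -[ltnLHS]addn0 ltn_add2l muln_gt0 expn_gt0 p0; lia.
Qed.

Lemma orbits_below_ge l : p ^ (m * l) <= orbits_below l.+1.
Proof.
rewrite orbits_belowS (leq_trans _ (leq_addl _ _)) //.
apply: (@leq_trans (p ^ (m * l + K).-1)); first by rewrite leq_exp2l //; lia.
by rewrite leq_pmull //; lia.
Qed.

(** The earlier spheres contribute at most [p ^ (m * l + K).-1], as [m > 0]; adding [p.-1] times
    this power gives the next power of [p]. *)
Lemma orbits_below_le l : orbits_below l.+1 <= p ^ (m * l + K).
Proof.
have step k : orbits_below k <= p ^ (m * k + K).-1 ->
    orbits_below k.+1 <= p ^ (m * k + K).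
  move=> h; rewrite orbits_belowS.
  have -> : p ^ (m * k + K) = p * p ^ (m * k + K).-1.
    by rewrite -expnS prednK // addn_gt0 K0 orbT.
  by rewrite -[X in _ <= X * _](prednK p0) mulSn leq_add2r.
elim: l => [|l IH]; first by apply: step; rewrite orbits_below0.
by apply: step; rewrite (leq_trans IH) // leq_exp2l //; lia.
Qed.

End OrbitsBelow.

(** Compares the levels at which two enumerations place the same index [n]: [p ^ (m * (l - 1)) <= n
    < p ^ (m' * l' + K')]. This is the source of the exponent [m / m']. *)
Lemma orbits_below_level_le p m K m' K' n l l' : (1 < p)%N ->
  (0 < m)%N -> (0 < m')%N -> (0 < K)%N -> (0 < K')%N ->
  (orbits_below p m K l <= n)%N -> (n < orbits_below p m' K' l'.+1)%N ->
  (m * l <= m' * l' + K' + m)%N.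
Proof.
move=> p2 m0 m'0 K0 K'0 h1 h2; case: l h1 => [|l] h1; first by rewrite muln0.
have h4 := orbits_below_ge p2 m0 K0 l.
have h3 := orbits_below_le p2 m'0 K'0 l'.
have : (p ^ (m * l) < p ^ (m' * l' + K'))%N by lia.
by rewrite ltn_exp2l //; nia.
Qed.

(** * Enumerating the balls that will be the orbits *)

Section Numbering.
Variables (R : realType) (p : nat) (p_pr : prime p).
Local Notation Qp := (Qp R p_pr).
Local Notation nrm := (@Qp_norm R p p_pr).
Local Notation q := (p%:R^-1 : R).
Implicit Types (x y z : Qp) (F : Qp -> Qp).

(** After division by [p ^ i], the balls of radius [q ^+ (i + k)] in the sphere are the residues
    modulo [p ^ k] prime to [p]. *)
Lemma sphere_label i k : (0 < k)%N -> exists t : Qp -> nat,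
  [/\ forall x, nrm x = q ^+ i -> (t x < p.-1 * p ^ k.-1)%N,
      forall x y, nrm x = q ^+ i -> nrm y = q ^+ i ->
        t x = t y <-> nrm (x - y) <= q ^+ (i + k) &
      forall s, (s < p.-1 * p ^ k.-1)%N -> exists2 x, nrm x = q ^+ i & t x = s].
Proof.
move=> k0; have p2 := prime_gt1 p_pr; have p0 := prime_gt0 p_pr.
have pk : (p ^ k = p * p ^ k.-1)%N by rewrite -expnS prednK.
have pi0 : p%:R ^+ i != 0 :> Qp by rewrite expf_neq0 // Qp_p_neq0.
have nd x y : nrm (x / p%:R ^+ i - y / p%:R ^+ i) <= q ^+ k <->
    nrm (x - y) <= q ^+ (i + k).
  rewrite -mulrBl Qp_normM Qp_normV Qp_normpX ler_pdivrMr ?pVX_gt0 //.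
  by rewrite -exprD addnC.
have unit_res x r : nrm x = q ^+ i -> nrm (x / p%:R ^+ i - r%:R) <= q ^+ k ->
    (0 < r %% p)%N.
  move=> xi xr; rewrite lt0n; apply/negP => pr.
  have : nrm (x / p%:R ^+ i) <= q ^+ 1.
    rewrite -[X in nrm X](subrK r%:R) Qp_normD_le //.
      by rewrite (le_trans xr) // pVX_le.
    by rewrite Qp_norm_nat_dvd // expn1 /dvdn.
  rewrite Qp_normM Qp_normV Qp_normpX xi divff ?lt0r_neq0 ?pVX_gt0 //.
  by rewrite expr1 leNgt pV_lt1.
have /choice[r hr] x : exists r, nrm x = q ^+ i ->
    (r < p ^ k)%N /\ nrm (x / p%:R ^+ i - r%:R) <= q ^+ k.
  have [xi|/eqP xi] := eqVneq (nrm x) (q ^+ i); last by exists 0%N => /xi.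
  have : nrm (x / p%:R ^+ i) <= 1.
    by rewrite Qp_normM Qp_normV Qp_normpX xi divff ?lt0r_neq0 ?pVX_gt0.
  by case/(Qp_residue k) => r rk xr; exists r.
(* Renumbers without gaps the integers prime to [p]: a row for each quotient by [p], and the
   remainders [1, ..., p - 1] as columns. *)
pose code a := (p.-1 * (a %/ p) + (a %% p).-1)%N.
have code_inj a b : (0 < a %% p)%N -> (0 < b %% p)%N -> code a = code b -> a = b.
  move=> a0 b0; rewrite /code => ab.
  have ap := ltn_pmod a p0; have bp := ltn_pmod b p0.
  have p1 : (0 < p.-1)%N by lia.
  have sa : ((a %% p).-1 < p.-1)%N by lia.
  have sb : ((b %% p).-1 < p.-1)%N by lia.
  have qa : (a %/ p = b %/ p)%N.
    have := congr1 (divn^~ p.-1) ab; rewrite ![(p.-1 * _)%N]mulnC.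
    by rewrite /= !divnMDl // (divn_small sa) (divn_small sb) !addn0.
  have ra : (a %% p = b %% p)%N.
    by have := ab; rewrite qa => /addnI; lia.
  by rewrite (divn_eq a p) (divn_eq b p) qa ra.
have rE x y : nrm x = q ^+ i -> nrm y = q ^+ i ->
    r x = r y <-> nrm (x - y) <= q ^+ (i + k).
  move=> xi yi; have [rx hx] := hr x xi; have [ry hy] := hr y yi.
  rewrite -nd; split=> [rxy|h].
    by apply: Qp_dist_le hx _; rewrite rxy Qp_normB.
  apply: (@Qp_residue_inj R p p_pr _ _ _ rx ry); rewrite Qp_normB in hx.
  exact: Qp_dist_le (Qp_dist_le hx h) hy.
exists (code \o r); split=> [x xi|x y xi yi|s sk] /=.
- have [rx /(unit_res _ _ xi) r0] := hr x xi.
  have : (r x %/ p < p ^ k.-1)%N by rewrite ltn_divLR // mulnC -pk.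
  have := ltn_pmod (r x) p0; rewrite /code; nia.
- rewrite -rE //; split=> [|->//]; apply: code_inj.
    by have [_ /(unit_res _ _ xi)] := hr x xi.
  by have [_ /(unit_res _ _ yi)] := hr y yi.
have p1 : (0 < p.-1)%N by lia.
set d := (s %% p.-1).+1; set a := (p * (s %/ p.-1) + d)%N.
have dp : (d < p)%N by have := ltn_pmod s p1; rewrite /d; lia.
have a_mod : (a %% p = d)%N by rewrite /a mulnC modnMDl modn_small.
have a_div : (a %/ p = s %/ p.-1)%N.
  by rewrite /a mulnC divnMDl // (divn_small dp) addn0.
have ak : (a < p ^ k)%N.
  have : (s %/ p.-1 < p ^ k.-1)%N by rewrite ltn_divLR // mulnC.
  by rewrite pk /a; nia.
have a0 : (0 < a)%N by rewrite /a /d addnS.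
have xi : nrm (a%:R * p%:R ^+ i) = q ^+ i.
  rewrite Qp_normM Qp_normpX Qp_norm_nat // lognE p_pr a0 /dvdn a_mod /=.
  by rewrite mul1r.
exists (a%:R * p%:R ^+ i) => //.
have [ra ha] := hr _ xi; rewrite mulfK // in ha.
have -> : r (a%:R * p%:R ^+ i) = a.
  by apply/esym/(@Qp_residue_inj R p p_pr _ _ _ ak ra).
by rewrite /code a_mod a_div /d /= mulnC -divn_eq.
Qed.

(** No map occurs: the balls in [number_eq] depend only on [m], [i0] and [K], and are the orbits of
    nonzero points for every germ with these parameters. [rep] picks a base point in each of
    them. *)
Record numbering (m i0 K : nat) (N : Qp -> nat) (rep : nat -> Qp) : Prop :=
  Numbering {
    rep_neq0 : forall n, rep n != 0 ;
    rep_le : forall n, nrm (rep n) <= q ^+ i0 ;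
    repK : forall n, N (rep n) = n ;
    number_level : forall x l, nrm x = q ^+ (i0 + l) ->
      (orbits_below p m K l <= N x < orbits_below p m K l.+1)%N ;
    number_eq : forall x y l, nrm x = q ^+ (i0 + l) ->
      y != 0 -> nrm y <= q ^+ i0 ->
      N x = N y <-> nrm (x - y) <= q ^+ (i0 + l + (m * l + K)) }.

Lemma Qp_level i x : x != 0 -> nrm x <= q ^+ i -> exists l, nrm x = q ^+ (i + l).
Proof.
move=> x0 xi; have : nrm x <= 1.
  by rewrite (le_trans xi) // -(expr0 q) pVX_le.
case/(Qp_norm_le1_val x0) => n xn; exists (n - i)%N.
by rewrite subnKC //; rewrite xn pVX_le in xi.
Qed.

(** The labels on each sphere are shifted by the number of orbits on the larger spheres. *)
Lemma numbering_exists m i0 K : (0 < m)%N -> (0 < K)%N ->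
  exists N rep, numbering m i0 K N rep.
Proof.
move=> m0 K0; have p2 := prime_gt1 p_pr.
set S := orbits_below p m K.
have S0 : S 0%N = 0%N by exact: orbits_below0.
have Slt l : (S l < S l.+1)%N by exact: orbits_below_lt.
have [t ht] := choice (fun l => @sphere_label (i0 + l) (m * l + K)
  (ltn_addl (m * l) K0)).
(* The level is characterized by implication, so that 0 can serve as default at the origin and
   outside the ball. *)
have /choice[lev hlev] x : exists l, forall l', nrm x = q ^+ (i0 + l') -> l' = l.
  have [x0|x0] := eqVneq x 0.
    exists 0%N => l; rewrite x0 Qp_norm0 => h.
    by have := pVX_gt0 R p_pr (i0 + l); rewrite -h ltxx.
  have [xi|xi] := boolP (nrm x <= q ^+ i0).
    have [l xl] := Qp_level x0 xi; exists l => l'; rewrite xl.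
    by move=> /(pVX_inj p_pr)/eqP; rewrite eqn_add2l => /eqP ->.
  by exists 0%N => l h; move: xi; rewrite h pVX_le // leq_addr.
pose N x := (S (lev x) + t (lev x) x)%N.
have NE x l : nrm x = q ^+ (i0 + l) -> N x = (S l + t l x)%N.
  by move=> xl; rewrite /N -(hlev x l xl).
have Nlev x l : nrm x = q ^+ (i0 + l) -> (S l <= N x < S l.+1)%N.
  move=> xl; rewrite (NE x l xl) leq_addr /= /S orbits_belowS ltn_add2l.
  by have [h _ _] := ht l; exact: h.
have /choice[rep hrep] n : exists x, (exists l, nrm x = q ^+ (i0 + l)) /\ N x = n.
  have [l /andP[ln nl]] := incr_step_find S0 Slt n.
  have [_ _ /(_ (n - S l)%N)] := ht l.
  case=> [|x xl tx]; first by move: nl; rewrite /S orbits_belowS -/S; lia.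
  exists x; split; first by exists l.
  by rewrite (NE x l xl) tx subnKC.
exists N, rep; split=> //.
- move=> n; have [[l xl] _] := hrep n; apply: contra_eq_neq xl => ->.
  by rewrite Qp_norm0 eq_sym lt0r_neq0 // pVX_gt0.
- by move=> n; have [[l ->] _] := hrep n; rewrite pVX_le // leq_addr.
- by move=> n; have [_] := hrep n.
move=> x y l xl y0 yi; have [l' yl] := Qp_level y0 yi.
have [_ hl _] := ht l.
split=> [Nxy|h].
  have El : l = l'.
    apply: (incr_step_uniq Slt (Nlev x l xl)).
    by rewrite Nxy Nlev.
  rewrite -El in yl; apply/hl => //.
  by move: Nxy; rewrite (NE x l xl) (NE y l yl) => /eqP; rewrite eqn_add2l => /eqP.
have yl1 : nrm y = q ^+ (i0 + l).
  rewrite -xl; apply: Qp_norm_near; rewrite (le_lt_trans h) // xl pVX_lt //.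
  by lia.
by rewrite (NE x l xl) (NE y l yl1); congr addn; apply/hl.
Qed.

End Numbering.

(** * Orbits of a germ as numbered balls *)

Section GermOrbits.
Variables (R : realType) (p : nat) (p_pr : prime p).
Local Notation Qp := (Qp R p_pr).
Local Notation nrm := (@Qp_norm R p p_pr).
Local Notation q := (p%:R^-1 : R).
Variables (m i0 K : nat) (F : Qp -> Qp) (gF : germ m i0 K F).
Implicit Types (x y z : Qp).

(** Stability of the ball follows from the Lipschitz condition against the fixed point 0. *)
Lemma germ_near_id : exists th,
  [/\ 0 < q ^+ i0, 0 <= th, th < q & near_id (q ^+ i0) th F].
Proof.
have [th [th0 thq lip]] := germ_lip gF; exists th; split=> //.
  exact: pVX_gt0.
split=> // x xi; have := lip x 0 xi.
rewrite (germ0 gF) subrr !subr0 Qp_norm0 => /(_ (ltW (pVX_gt0 _ p_pr _))) h.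
have [->|x0] := eqVneq x 0.
  by rewrite (germ0 gF) Qp_norm0 ltW // pVX_gt0.
rewrite -[F x](subrKC x) Qp_norm_addl // (le_lt_trans h) // gtr_pMl.
  exact: lt_trans thq (pV_lt1 R p_pr).
exact: Qp_norm_gt0.
Qed.

Lemma germ_isom x y : nrm x <= q ^+ i0 -> nrm y <= q ^+ i0 ->
  nrm (F x - F y) = nrm (x - y).
Proof. by have [th [r0 t0 tq nF]] := germ_near_id; exact: near_id_isom nF. Qed.

Lemma germ_norm_iter n x : nrm x <= q ^+ i0 -> nrm (iter n F x) = nrm x.
Proof.
have [th [r0 t0 tq nF]] := germ_near_id => xi.
have F0 k : iter k F 0 = 0 by elim: k => //= k ->; rewrite (germ0 gF).
rewrite -[iter n F x]subr0 -(F0 n).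
have nFn := near_id_iter t0 tq n nF.
rewrite (near_id_isom tq nFn) // ?subr0 //.
by rewrite Qp_norm0 ltW.
Qed.

Lemma germ_iter_dist n k x : nrm x <= q ^+ i0 ->
  nrm (iter n F x - iter k F x) = nrm (n%:R - k%:R : Qp) * nrm (F x - x).
Proof.
have [th [r0 t0 tq nF]] := germ_near_id => xi.
exact: near_id_iter_dist nF xi.
Qed.

Lemma germ_iter_le n x : nrm x <= q ^+ i0 ->
  nrm (iter n F x - x) <= nrm (F x - x).
Proof.
have [th [r0 t0 tq nF]] := germ_near_id => xi.
exact: near_id_iter_le nF xi.
Qed.

Lemma germ_orbit_dense x y j : nrm x <= q ^+ i0 ->
  nrm (y - x) <= nrm (F x - x) ->
  exists n, nrm (iter n F x - y) <= q ^+ j * nrm (F x - x).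
Proof.
have [th [r0 t0 tq nF]] := germ_near_id => xi.
exact: near_id_orbit_dense nF xi.
Qed.

Lemma germ_surj y : nrm y <= q ^+ i0 -> exists2 x, nrm x <= q ^+ i0 & F x = y.
Proof.
have [th [r0 t0 tq nF]] := germ_near_id => xi.
exact: near_id_surj nF xi.
Qed.

Variables (N : Qp -> nat) (rep : nat -> Qp) (nN : numbering m i0 K N rep).

Lemma rep_disp_gt0 n : 0 < nrm (F (rep n) - rep n).
Proof.
have [l xl] := Qp_level (rep_neq0 nN n) (rep_le nN n).
by rewrite (germ_norm gF xl) pVX_gt0.
Qed.

Lemma number_orbit x : x != 0 -> nrm x <= q ^+ i0 ->
  nrm (x - rep (N x)) <= nrm (F (rep (N x)) - rep (N x)).
Proof.
move=> x0 xi; set r := rep (N x).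
have [l rl] := Qp_level (rep_neq0 nN (N x)) (rep_le nN (N x)).
rewrite (germ_norm gF rl) Qp_normB; apply/(number_eq nN rl x0 xi).
by rewrite (repK nN).
Qed.

(** With [number_orbit], this identifies the points numbered [n] with the ball of radius
    [|F (rep n) - rep n|] around [rep n]. As [K > 0], that ball stays inside one sphere. *)
Lemma orbit_number n x : nrm (x - rep n) <= nrm (F (rep n) - rep n) ->
  [/\ x != 0, nrm x = nrm (rep n) & N x = n].
Proof.
move=> h; have [l rl] := Qp_level (rep_neq0 nN n) (rep_le nN n).
rewrite (germ_norm gF rl) Qp_normB in h.
have xr : nrm x = nrm (rep n).
  apply: Qp_norm_near; rewrite (le_lt_trans h) // rl pVX_lt //.
  by have := germ_K gF; lia.
have x0 : x != 0.
  have r0 := Qp_norm_gt0 (rep_neq0 nN n).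
  by apply: contraTneq r0 => x0; rewrite -xr x0 Qp_norm0 ltxx.
split=> //; rewrite -[RHS](repK nN); apply/esym/(number_eq nN rl x0) => //.
by rewrite xr (rep_le nN).
Qed.

Lemma number_closure x y : x != 0 -> nrm x <= q ^+ i0 ->
  Zp_orbit F x y -> [/\ y != 0, nrm y <= q ^+ i0 & N y = N x].
Proof.
move=> x0 xi /Qp_closureP cl; have r0 := rep_disp_gt0 (N x).
have [_ [n _ <-] hn] := cl _ r0.
have : nrm (y - rep (N x)) <= nrm (F (rep (N x)) - rep (N x)).
  apply: (@Qp_dist_le _ _ _ (iter n F x)); first by rewrite Qp_normB ltW.
  apply: (@Qp_dist_le _ _ _ x); last exact: number_orbit.
  apply: le_trans (germ_iter_le n xi) _.
  have [l xl] := Qp_level x0 xi.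
  have [_ xr _] := orbit_number (number_orbit x0 xi).
  by rewrite (germ_norm gF xl) (germ_norm gF (_ : nrm (rep (N x)) = q ^+ (i0 + l))) -?xr.
by case/orbit_number => y0 -> ->; rewrite (rep_le nN).
Qed.

End GermOrbits.

(** * The correspondence between points reached at the same time in orbits of the same index *)

Section Matching.
Variables (R : realType) (p : nat) (p_pr : prime p).
Local Notation Qp := (Qp R p_pr).
Local Notation nrm := (@Qp_norm R p p_pr).
Local Notation q := (p%:R^-1 : R).
Implicit Types (x y z : Qp) (F G : Qp -> Qp) (rep : nat -> Qp).

(* [x] and [y] are the limits of [F^k (rep n)] and [G^k (rep' n)] as [k] tends
   to the same [p]-adic integer. *)
Definition match_at F rep G rep' (n : nat) x y : Prop := forall j, exists k,
  nrm (iter k F (rep n) - x) <= q ^+ j * nrm (F (rep n) - rep n) /\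
  nrm (iter k G (rep' n) - y) <= q ^+ j * nrm (G (rep' n) - rep' n).

Definition matched F rep G rep' x y : Prop :=
  (x = 0 /\ y = 0) \/ exists n, match_at F rep G rep' n x y.

Lemma match_at_sym F rep G rep' n x y :
  match_at F rep G rep' n x y -> match_at G rep' F rep n y x.
Proof. by move=> h j; have [k [h1 h2]] := h j; exists k. Qed.

Lemma matched_sym F rep G rep' x y :
  matched F rep G rep' x y -> matched G rep' F rep y x.
Proof.
case=> [[-> ->]|[n /match_at_sym h]]; [by left|by right; exists n].
Qed.

Section OneSided.
Variables (m i0 K : nat) (F : Qp -> Qp) (gF : germ m i0 K F).
Variables (N : Qp -> nat) (rep : nat -> Qp) (nN : numbering m i0 K N rep).
Variables (m' i0' K' : nat) (G : Qp -> Qp) (gG : germ m' i0' K' G).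
Variables (N' : Qp -> nat) (rep' : nat -> Qp).
Variables (nN' : numbering m' i0' K' N' rep').
Local Notation dF n := (nrm (F (rep n) - rep n)).
Local Notation dG n := (nrm (G (rep' n) - rep' n)).

Lemma match_at_orbit n x y : match_at F rep G rep' n x y ->
  nrm (x - rep n) <= dF n.
Proof.
case/(_ 0%N) => k [h _]; rewrite expr0 mul1r in h.
apply: (@Qp_dist_le _ _ _ (iter k F (rep n))); first by rewrite Qp_normB.
by apply: (germ_iter_le gF); exact: rep_le nN n.
Qed.

Lemma match_at_number n x y : match_at F rep G rep' n x y ->
  [/\ x != 0, nrm x = nrm (rep n) & N x = n].
Proof. by move=> /match_at_orbit; exact: (orbit_number gF nN). Qed.

Lemma matched_dom x y : matched F rep G rep' x y -> nrm x <= q ^+ i0.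
Proof.
case=> [[-> _]|[n /match_at_number[_ -> _]]]; last exact: rep_le nN n.
by rewrite Qp_norm0 ltW // pVX_gt0.
Qed.

(** The distance between the iterates at times [k] and [l] is [|k - l|] times the displacement, for
    [F] and for [G]. Passing to the limit, matched distances are proportional to the displacements;
    the reverse inequality is obtained by exchanging the maps. *)
Lemma match_at_dist_le n x y x1 y1 :
  match_at F rep G rep' n x y -> match_at F rep G rep' n x1 y1 ->
  nrm (y - y1) * dF n <= nrm (x - x1) * dG n.
Proof.
move=> h h1; have dF0 := rep_disp_gt0 gF nN n.
have dG0 := rep_disp_gt0 gG nN' n.
rewrite leNgt; apply/negP => lt.
have pos : 0 < nrm (y - y1) * dF n.
  by rewrite (le_lt_trans _ lt) // mulr_ge0 ?Qp_norm_ge0.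
(* A precision at which the approximation errors, at most [q ^+ j] times a displacement, fall below
   the assumed discrepancy. *)
have [j hj] := pVX_small p_pr (divr_gt0 pos (mulr_gt0 dF0 dG0)).
rewrite ltr_pdivlMr ?mulr_gt0 // in hj.
have [k [hx hy]] := h j; have [l [hx1 hy1]] := h1 j.
set M := nrm (y - y1) * dF n in lt pos hj.
have kl : nrm (k%:R - l%:R : Qp) * dF n * dG n < M.
  rewrite -(germ_iter_dist gF k l (rep_le nN n)).
  have : nrm (iter k F (rep n) - iter l F (rep n)) <=
      Num.max (q ^+ j * dF n) (nrm (x - x1)).
    apply: (@Qp_dist_le _ _ _ x); first by rewrite le_max hx.
    apply: (@Qp_dist_le _ _ _ x1); first by rewrite le_max lexx orbT.
    by rewrite Qp_normB le_max hx1.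
  rewrite le_max => /orP[h2|h2].
    by rewrite (le_lt_trans _ hj) // mulrA ler_wpM2r // ltW.
  by rewrite (le_lt_trans _ lt) // ler_wpM2r // ltW.
have le_max_y : nrm (y - y1) <=
    Num.max (q ^+ j * dG n) (nrm (k%:R - l%:R : Qp) * dG n).
  apply: (@Qp_dist_le _ _ _ (iter k G (rep' n))).
    by rewrite Qp_normB le_max hy.
  apply: (@Qp_dist_le _ _ _ (iter l G (rep' n))); last by rewrite le_max hy1.
  by rewrite (germ_iter_dist gG k l (rep_le nN' n)) le_max lexx orbT.
have lt_max_y : Num.max (q ^+ j * dG n) (nrm (k%:R - l%:R : Qp) * dG n) * dF n < M.
  rewrite maxr_pMl ?(ltW dF0) // gt_max (mulrAC (nrm (_ - _))) kl andbT.
  by rewrite -mulrA [X in _ * X]mulrC.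
have := le_lt_trans (ler_wpM2r (ltW dF0) le_max_y) lt_max_y.
by rewrite /M ltxx.
Qed.

(** Times [k j] at which the [F]-orbit of [rep n] approaches [x] satisfy [|k j - k l| <= q ^+ j] for
    [j <= l], so the iterates of [rep' n] under [G] at the same times converge. *)
Lemma matched_total x : nrm x <= q ^+ i0 -> exists y, matched F rep G rep' x y.
Proof.
move=> xi; have [->|x0] := eqVneq x 0; first by exists 0; left.
set n := N x; have dF0 := rep_disp_gt0 gF nN n.
have dG0 := rep_disp_gt0 gG nN' n.
have /choice[k hk] j : exists k, nrm (iter k F (rep n) - x) <= q ^+ j * dF n.
  apply: (germ_orbit_dense gF _ (rep_le nN n)).
  exact: (number_orbit gF nN).
pose u j := iter (k j) G (rep' n).
have uB j l : (j <= l)%N -> nrm (u j - u l) <= q ^+ j * dG n.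
  move=> jl; rewrite (germ_iter_dist gG _ _ (rep_le nN' n)) ler_pM2r //.
  rewrite -(ler_pM2r dF0) -(germ_iter_dist gF _ _ (rep_le nN n)).
  apply: (@Qp_dist_le _ _ _ x) => //; rewrite Qp_normB (le_trans (hk l)) //.
  by rewrite ler_pM2r // pVX_le.
have [y hy] : exists y, forall e, 0 < e -> exists M, forall i, (M <= i)%N ->
     nrm (u i - y) < e.
  apply: Qp_complete => e e0.
  have [M hM] := pVX_small p_pr (divr_gt0 e0 dG0).
  rewrite ltr_pdivlMr // in hM; exists M => i j Mi Mj.
  apply: (@Qp_dist_lt _ _ _ (u M)); last exact: le_lt_trans (uB _ _ Mj) hM.
  by rewrite Qp_normB; exact: le_lt_trans (uB _ _ Mi) hM.
exists y; right; exists n => j; exists (k j); split; first exact: hk.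
have [M hM] := hy _ (mulr_gt0 (pVX_gt0 R p_pr j) dG0).
apply: (@Qp_dist_le _ _ _ (u (maxn j M))); first exact/uB/leq_maxl.
exact/ltW/hM/leq_maxr.
Qed.

(** The times [k] become [k.+1], and the errors are unchanged because both maps are isometries. *)
Lemma matched_equivariant x y :
  matched F rep G rep' x y -> matched F rep G rep' (F x) (G y).
Proof.
move=> xy; have xi := matched_dom xy.
case: xy => [[-> ->]|[n h]]; first by left; rewrite !(germ0 gF, germ0 gG).
have [_ yr _] : [/\ y != 0, nrm y = nrm (rep' n) & N' y = n].
  have [k] := h 0%N; rewrite expr0 !mul1r => -[_ hy].
  apply: (orbit_number gG nN'); apply: (@Qp_dist_le _ _ _ (iter k G (rep' n))).
    by rewrite Qp_normB.
  by apply: (germ_iter_le gG); exact: rep_le nN' n.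
right; exists n => j; have [k [h1 h2]] := h j; exists k.+1.
rewrite !iterS (germ_isom gF) // ?(germ_isom gG) //.
- by rewrite (germ_norm_iter gG _ (rep_le nN' n)) (rep_le nN').
- by rewrite yr (rep_le nN').
- by rewrite (germ_norm_iter gF _ (rep_le nN n)) (rep_le nN).
Qed.

End OneSided.

End Matching.

(** * Uniqueness, continuity and Hölder bounds for the matching *)

Section Conjugacy.
Variables (R : realType) (p : nat) (p_pr : prime p).
Local Notation Qp := (Qp R p_pr).
Local Notation nrm := (@Qp_norm R p p_pr).
Local Notation q := (p%:R^-1 : R).
Implicit Types (x y z : Qp).

(** Reduces a Hölder bound with constant [q ^- c] to an inequality between natural numbers. *)
Lemma pVX_le_powR (A B c m m' : nat) : (0 < m')%N ->
  (B * m <= (A + c) * m')%N ->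
  q ^+ A <= q ^- c * ((q ^+ B) `^ (m%:R / m'%:R)).
Proof.
move=> m'0 h; have q0 := pV_gt0 R p_pr; have m'R : 0 < m'%:R :> R by rewrite ltr0n.
rewrite -(ler_pM2l (pVX_gt0 R p_pr c)) mulVKf ?lt0r_neq0 ?pVX_gt0 //.
rewrite -exprD -!powR_mulrn ?(ltW q0) // -powRrM.
apply: ger_powR; first by rewrite q0 ltW // pV_lt1.
rewrite mulrA ler_pdivrMr // -!natrM ler_nat.
by rewrite (leq_trans h) // addnC.
Qed.

Lemma Zp_orbit_fix0 (F : Qp -> Qp) x : F 0 = 0 -> Zp_orbit F 0 x -> x = 0.
Proof.
move=> F0 /Qp_closureP cl; apply/eqP/negPn/negP => /Qp_norm_gt0 x0.
have [_ [n _ <-]] := cl _ x0.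
have -> : iter n F 0 = 0 by elim: n => //= n ->.
by rewrite sub0r Qp_normN ltxx.
Qed.

Section OneSided.
Variables (m i0 K : nat) (F : Qp -> Qp) (gF : germ m i0 K F).
Variables (N : Qp -> nat) (rep : nat -> Qp) (nN : numbering m i0 K N rep).
Variables (m' i0' K' : nat) (G : Qp -> Qp) (gG : germ m' i0' K' G).
Variables (N' : Qp -> nat) (rep' : nat -> Qp).
Variables (nN' : numbering m' i0' K' N' rep').
Local Notation dF n := (nrm (F (rep n) - rep n)).
Local Notation dG n := (nrm (G (rep' n) - rep' n)).
Local Notation matched := (matched F rep G rep').

Lemma match_at_dist n x y x1 y1 :
  match_at F rep G rep' n x y -> match_at F rep G rep' n x1 y1 ->
  nrm (y - y1) * dF n = nrm (x - x1) * dG n.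
Proof.
move=> h h1; apply/le_anti/andP; split.
  exact (match_at_dist_le gF nN gG nN' h h1).
exact (match_at_dist_le gG nN' gF nN (match_at_sym h) (match_at_sym h1)).
Qed.

Lemma matched_at x y : x != 0 -> matched x y -> match_at F rep G rep' (N x) x y.
Proof.
move=> x0 [[xz _]|[n h]]; first by rewrite xz eqxx in x0.
by have [_ _ ->] := match_at_number gF nN h.
Qed.

Lemma matched_uniq x y y1 : matched x y -> matched x y1 -> y = y1.
Proof.
have [->|x0] := eqVneq x 0.
  have z w : matched 0 w -> w = 0.
    case=> [[]//|[n h]].
    by have [/eqP] := match_at_number gF nN h.
  by move=> /z -> /z ->.
move=> /(matched_at x0) h /(matched_at x0) h1.
have := match_at_dist h h1; rewrite subrr Qp_norm0 mul0r => /eqP.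
rewrite mulf_eq0 (gt_eqF (rep_disp_gt0 gF nN (N x))) orbF.
by move=> /eqP /Qp_norm_eq0 /eqP; rewrite subr_eq0 => /eqP.
Qed.

(** Matched points carry the same index, so the counting estimate applies in both directions to
    their levels. *)
Lemma match_at_levels n x y : match_at F rep G rep' n x y -> exists l l',
  [/\ nrm x = q ^+ (i0 + l), nrm y = q ^+ (i0' + l'),
      dF n = q ^+ (i0 + l + (m * l + K)),
      dG n = q ^+ (i0' + l' + (m' * l' + K')) &
      (m * l <= m' * l' + K' + m)%N /\ (m' * l' <= m * l + K + m')%N].
Proof.
move=> h; have [_ xr _] := match_at_number gF nN h.
have [_ yr _] := match_at_number gG nN' (match_at_sym h).
have [l rl] := Qp_level (rep_neq0 nN n) (rep_le nN n).
have [l' rl'] := Qp_level (rep_neq0 nN' n) (rep_le nN' n).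
exists l, l'; rewrite xr yr; split=> //.
- exact (germ_norm gF rl).
- exact (germ_norm gG rl').
have /andP[h1 h2] := number_level nN rl; rewrite (repK nN) in h1 h2.
have /andP[h3 h4] := number_level nN' rl'; rewrite (repK nN') in h3 h4.
have p1 := prime_gt1 p_pr.
have := orbits_below_level_le p1 (germ_m gG) (germ_m gF) (germ_K gG)
  (germ_K gF) h3 h2.
have := orbits_below_level_le p1 (germ_m gF) (germ_m gG) (germ_K gF)
  (germ_K gG) h1 h4.
by split.
Qed.

(** At 0 this is the comparison of levels; elsewhere a nearby point lies in the same orbit, on which
    [h] is a similarity. *)
Lemma matched_continuous h : (forall x, nrm x <= q ^+ i0 -> matched x (h x)) ->
  {within [set x | nrm x <= q ^+ i0], continuous h}.
Proof.
move=> hM; apply/Qp_continuous_withinP => x /= xi e e0.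
have [->|x0] := eqVneq x 0.
  have h0 : h 0 = 0.
    apply: (@matched_uniq 0); last by left.
    by apply: hM; rewrite Qp_norm0 ltW // pVX_gt0.
  have [J hJ] := pVX_small p_pr e0.
  (* A smaller norm means a level [l > m' * J + K' + m], and then [m * l <= m' * l' + K' + m] forces
     [l' > J]. *)
  exists (q ^+ (i0 + (m' * J + K' + m))); first exact: pVX_gt0.
  move=> y yi; rewrite h0 !subr0 => ylt.
  have [->|y0] := eqVneq y 0; first by rewrite h0 Qp_norm0.
  have [l [l' [yl hyl _ _ [ll _]]]] := match_at_levels (matched_at y0 (hM y yi)).
  rewrite hyl (le_lt_trans _ hJ) // pVX_le //.
  move: ylt; rewrite yl pVX_lt // => ylt.
  have := germ_m gF; have := germ_m gG; nia.
have [l xl] := Qp_level x0 xi.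
have dF0 := rep_disp_gt0 gF nN (N x); have dG0 := rep_disp_gt0 gG nN' (N x).
exists (Num.min (e * dF (N x) / dG (N x)) (dF (N x))).
  by rewrite lt_min dF0 divr_gt0 // mulr_gt0.
move=> y yi; rewrite lt_min => /andP[xy1 xy2].
have [y0 _ yN] : [/\ y != 0, nrm y = nrm (rep (N x)) & N y = N x].
  apply: (orbit_number gF nN); apply: (@Qp_dist_le _ _ _ x); first exact: ltW.
  exact (number_orbit gF nN x0 xi).
have My := matched_at y0 (hM y yi); rewrite yN in My.
rewrite -(ltr_pM2r dF0) (match_at_dist My (matched_at x0 (hM x xi))).
by rewrite -ltr_pdivlMr.
Qed.

Lemma same_orbit_number x y :
  same_Zp_orbit F [set x | nrm x <= q ^+ i0] x y ->
  (x = 0 /\ y = 0) \/ [/\ x != 0, y != 0 & N x = N y].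
Proof.
case=> z zi [zx zy]; have [z0|z0] := eqVneq z 0.
  rewrite z0 in zx zy.
  by left; rewrite (Zp_orbit_fix0 (germ0 gF) zx) (Zp_orbit_fix0 (germ0 gF) zy).
have [x0 _ xN] := number_closure gF nN z0 zi zx.
have [y0 _ yN] := number_closure gF nN z0 zi zy.
by right; rewrite xN yN.
Qed.

(* Since matched orbits are similar, the Hölder estimate on an orbit only
   involves the norms of the displacements at a given level. *)
Lemma matched_orbit_hoelder h c d d' :
  (forall x, nrm x <= q ^+ i0 -> matched x (h x)) -> (0 < d')%N ->
  (forall l l' t, (m * l <= m' * l' + K' + m)%N ->
    (m' * l' <= m * l + K + m')%N ->
    ((i0 + l + (m * l + K) + t) * d <=
      (i0' + l' + (m' * l' + K') + t + c) * d')%N) ->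
  forall x y, nrm x <= q ^+ i0 -> nrm y <= q ^+ i0 ->
    same_Zp_orbit F [set x | nrm x <= q ^+ i0] x y ->
    nrm (h y - h x) <= q ^- c * (nrm (y - x) `^ (d%:R / d'%:R)).
Proof.
move=> hM d'0 cE x y xi yi /same_orbit_number xy.
have pos z : 0 <= q ^- c * (nrm z `^ (d%:R / d'%:R)).
  by rewrite mulr_ge0 ?powR_ge0 // invr_ge0 ltW // pVX_gt0.
case: xy => [[-> ->]|[x0 y0 xyN]].
  by rewrite subrr [X in X <= _]Qp_norm0.
have [->|xy] := eqVneq x y; first by rewrite subrr [X in X <= _]Qp_norm0.
have Mx := matched_at x0 (hM x xi); have My := matched_at y0 (hM y yi).
rewrite -xyN in My.
have [l [l' [_ _ dFE dGE [ll1 ll2]]]] := match_at_levels Mx.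
have := match_at_dist My Mx; rewrite dFE dGE => E.
have yx_le : nrm (y - x) <= q ^+ (i0 + l + (m * l + K)).
  rewrite -dFE; apply: (@Qp_dist_le _ _ _ (rep (N x))).
    exact (match_at_orbit gF nN My).
  by rewrite Qp_normB; exact (match_at_orbit gF nN Mx).
have yx0 : y - x != 0 by rewrite subr_eq0 eq_sym.
(* [t] measures how much smaller than the displacement [|y - x|] is; by similarity the same [t]
   occurs on the image side. *)
have [t yxt] := Qp_level yx0 yx_le.
have -> : nrm (h y - h x) = q ^+ (i0' + l' + (m' * l' + K') + t).
  apply: (mulIf (lt0r_neq0 (pVX_gt0 R p_pr (i0 + l + (m * l + K))))).
  by rewrite E yxt -!exprD; congr (_ ^+ _); lia.
by rewrite yxt pVX_le_powR // cE.
Qed.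

End OneSided.
End Conjugacy.

(** * Arithmetic for a common Hölder constant *)

Section Exponents.
Local Open Scope nat_scope.

Variables (m m' i0 i0' K K' : nat).

(** The constant of all three estimates is [C = q ^- hoelder_shift]. The factor [m.+1] covers both
    the parameters themselves and their products with [m]. *)
Definition hoelder_shift := (i0 + i0' + K + K' + m + m') * m.+1.

Hypotheses (m'0 : 0 < m').

Let shift_le : hoelder_shift <= hoelder_shift * m'.
Proof. by rewrite leq_pmulr. Qed.

Let shiftE : hoelder_shift =
  i0 * m + i0' * m + K * m + K' * m + m * m + m' * m + i0 + i0' + K + K' + m + m'.
Proof. by rewrite /hoelder_shift mulnS !mulnDl; lia. Qed.

Lemma hoelder_shift_norm l l' : m * l <= m' * l' + K' + m ->
  (i0 + l) * m <= (i0' + l' + hoelder_shift) * m'.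
Proof.
move=> h; rewrite !mulnDl (mulnC l) (mulnC l').
by have := shift_le; move: shiftE; lia.
Qed.

Lemma hoelder_shift_fwd l l' t : m <= m' -> m * l <= m' * l' + K' + m ->
  (i0 + l + (m * l + K) + t) * m <=
    (i0' + l' + (m' * l' + K') + t + hoelder_shift) * m'.
Proof.
move=> mm' h.
have h1 : t * m <= t * m' by rewrite leq_mul2l mm' orbT.
have h2 : m * l * m <= (m' * l' + K' + m) * m by rewrite leq_mul2r h orbT.
have h3 : (m' * l') * m <= (m' * l') * m' by rewrite leq_mul2l mm' orbT.
rewrite !mulnDl (mulnC l) (mulnC l'); rewrite !mulnDl in h2.
by have := shift_le; move: shiftE; lia.
Qed.

Lemma hoelder_shift_bwd l l' t : m <= m' -> m' * l' <= m * l + K + m' ->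
  (i0' + l' + (m' * l' + K') + t) * m <=
    (i0 + l + (m * l + K) + t + hoelder_shift) * m'.
Proof.
move=> mm' h.
have h1 : t * m <= t * m' by rewrite leq_mul2l mm' orbT.
have h2 : m' * l' * m <= (m * l + K + m') * m by rewrite leq_mul2r h orbT.
have h3 : (m * l) * m <= (m * l) * m' by rewrite leq_mul2l mm' orbT.
have h4 : l' * m <= l' * m' by rewrite leq_mul2l mm' orbT.
have h5 : l * m <= l * m' by rewrite leq_mul2l mm' orbT.
rewrite !mulnDl; rewrite !mulnDl in h2.
by have := shift_le; move: shiftE; lia.
Qed.

End Exponents.

(** * The conjugacy on balls, and optimality of the exponent *)

Section MainResults.
Variables (R : realType) (p : nat) (p_pr : prime p).
Local Notation Qp := (Qp R p_pr).
Local Notation nrm := (@Qp_norm R p p_pr).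
Local Notation q := (p%:R^-1 : R).
Implicit Types (x y z : Qp) (f g : nat -> Qp).

Lemma ltr_powR_lt1 (a x y : R) : 0 < a -> a < 1 -> x < y -> a `^ y < a `^ x.
Proof.
move=> a0 a1 xy; rewrite /powR gt_eqF // ltr_expR ltr_nM2r // ln_lt0 //.
by rewrite a0.
Qed.

Lemma germ_image_ball m i0 K (F : Qp -> Qp) : germ m i0 K F ->
  F @` [set x | nrm x <= q ^+ i0] = [set x | nrm x <= q ^+ i0].
Proof.
move=> gF; apply/seteqP; split=> [_ [x /= xi <-]|y /= yi].
  by rewrite (germ_norm_iter gF 1 xi).
by have [x xi <-] := germ_surj gF yi; exists x.
Qed.

Lemma ball_nbhs0 i : nbhs (0 : Qp) [set x : Qp | nrm x <= q ^+ i].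
Proof.
apply/Qp_nbhsP; exists (q ^+ i); first exact: pVX_gt0.
by move=> y; rewrite subr0 => /ltW.
Qed.

(** Everything rests on uniqueness of the matched point: symmetry of the matching makes [h] and [k]
    inverse to each other, and its equivariance makes [h] commute with the two maps. *)
Lemma germs_conjugacy f g m i0 K N rep m' i0' K' N' rep' (h k : Qp -> Qp) :
  germ m i0 K (peval f) -> (forall x, nrm x <= q ^+ i0 -> conv_dom f x) ->
  numbering m i0 K N rep ->
  germ m' i0' K' (peval g) -> (forall x, nrm x <= q ^+ i0' -> conv_dom g x) ->
  numbering m' i0' K' N' rep' ->
  (forall x, nrm x <= q ^+ i0 -> matched (peval f) rep (peval g) rep' x (h x)) ->
  (forall y, nrm y <= q ^+ i0' -> matched (peval g) rep' (peval f) rep y (k y)) ->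
  conjugacy f g [set x | nrm x <= q ^+ i0] [set x | nrm x <= q ^+ i0'] h k.
Proof.
move=> gF cF nN gG cG nN' hM kM.
have hB x : nrm x <= q ^+ i0 -> nrm (h x) <= q ^+ i0'.
  by move=> /hM/matched_sym h1; exact (matched_dom gG nN' h1).
have kB y : nrm y <= q ^+ i0' -> nrm (k y) <= q ^+ i0.
  by move=> /kM/matched_sym h1; exact (matched_dom gF nN h1).
have z0 i : nrm 0 <= q ^+ i by rewrite Qp_norm0 ltW // pVX_gt0.
split.
- exact: ball_nbhs0.
- exact: ball_nbhs0.
- exact: cF.
- exact: cG.
- exact: germ_image_ball gF.
- exact: germ_image_ball gG.
- split.
  + by move=> x; exact: hB.
  + by move=> x; exact: kB.
  + move=> x /set_mem /= xi; have h1 := matched_sym (hM x xi).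
    by apply: (matched_uniq gG nN' gF nN (kM _ (hB x xi)) h1).
  + move=> y /set_mem /= yi; have h1 := matched_sym (kM y yi).
    by apply: (matched_uniq gF nN gG nN' (hM _ (kB y yi)) h1).
  + exact (matched_continuous gF nN gG nN' hM).
  + exact (matched_continuous gG nN' gF nN kM).
- have h0 : matched (peval f) rep (peval g) rep' 0 0 by left.
  exact (matched_uniq gF nN gG nN' (hM 0 (z0 i0)) h0).
move=> x /= xi.
have Fxi : nrm (peval f x) <= q ^+ i0 by rewrite (germ_norm_iter gF 1 xi).
have h1 := matched_equivariant gF nN gG nN' (hM x xi).
exact (matched_uniq gF nN gG nN' (hM _ Fxi) h1).
Qed.

Lemma conjugacy_iter f g U1 U2 (h k : Qp -> Qp) n x :
  conjugacy f g U1 U2 h k -> U1 x ->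
  U1 (iter n (peval f) x) /\ h (iter n (peval f) x) = iter n (peval g) (h x).
Proof.
move=> cj Ux; elim: n => [//|n [IH1 IH2]] /=; split.
  by rewrite -(conj_stable1 cj); exists (iter n (peval f) x).
by rewrite (conj_comm cj IH1) IH2.
Qed.

(** Iterates of [x] close to [y] are carried to iterates of [h x] close to [h y], by continuity of
    [h] within [U1] at [y]. *)
Lemma conjugacy_same_orbit f g U1 U2 (h k : Qp -> Qp) x y :
  conjugacy f g U1 U2 h k -> U1 x -> U1 y ->
  Zp_orbit (peval f) x y -> Zp_orbit (peval g) (h x) (h y).
Proof.
move=> cj Ux Uy /Qp_closureP cl; apply/Qp_closureP => e e0.
have [d d0 hd] :=
  (Qp_continuous_withinP U1 h).1 (homeo_cont (conj_homeo cj)) y Uy e e0.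
have [_ [n _ <-] hn] := cl d d0.
have [Un En] := conjugacy_iter n cj Ux.
by exists (iter n (peval g) (h x)); [exists n|rewrite -En; exact: hd].
Qed.

(** The hypothesis bounds [m * l + K] by [(m / alpha) * (L + c) + K], which is eventually below
    [m' * L] because its slope [m / alpha] is less than [m']. *)
Lemma exponent_gap (m m' K c : nat) (alpha : R) : (0 < m')%N ->
  m%:R / m'%:R < alpha ->
  exists L : nat, forall l : nat, l%:R * alpha <= (L + c)%:R ->
    (m * l + K < m' * L)%N.
Proof.
move=> m'0 ha; have m'R : 0 < m'%:R :> R by rewrite ltr0n.
have a0 : 0 < alpha by rewrite (le_lt_trans _ ha) // divr_ge0.
set d := m'%:R * alpha - m%:R.
have d0 : 0 < d by rewrite subr_gt0 mulrC -ltr_pdivrMr.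
(* After multiplication by [alpha], the inequality reduces to [m * c + K * alpha < L * d]. *)
set B := (m%:R * c%:R + K%:R * alpha) / d.
have [L hL] : exists L : nat, B < L%:R.
  exists (Num.truncn B).+1; exact: truncnS_gt.
exists L => l hl; rewrite -(ltr_nat R) natrD !natrM -(ltr_pM2r a0).
rewrite ltr_pdivrMr // in hL.
apply: (@le_lt_trans _ _ (m%:R * (L%:R + c%:R) + K%:R * alpha)).
  rewrite mulrDl lerD2r -mulrA ler_wpM2l //.
  by rewrite -natrD.
rewrite mulrDr -addrA -ltrBrDl (lt_le_trans hL) // /d.
by rewrite mulrBr mulrCA mulrA [L%:R * m%:R]mulrC.
Qed.

(* If [h] were Hölder at [0] with a larger exponent, then [k] would inject the
   [g]-orbits meeting the complement of a small ball into too few [f]-orbits. *)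
Lemma conjugacy_exponent_le f g m m' a a' U1 U2 (h k : Qp -> Qp)
    (C alpha : R) :
  Qp_analytic f -> Qp_analytic g -> (0 < m)%N -> (0 < m')%N ->
  a <> 0 -> a' <> 0 -> tangent_to_id f m a -> tangent_to_id g m' a' ->
  conjugacy f g U1 U2 h k -> 0 < C ->
  (forall x, U1 x -> nrm (h x) <= C * (nrm x `^ alpha)) ->
  alpha <= m%:R / m'%:R.
Proof.
move=> f_an g_an m0 m'0 a0 a'0 fE gE cj C0 hC.
rewrite leNgt; apply/negP => alpha_gt.
have alpha0 : 0 < alpha by rewrite (le_lt_trans _ alpha_gt) // divr_ge0.
have U20 : U2 0 := nbhs_singleton (conj_nbhs2 cj).
have k0 : k 0 = 0.
  have U10 : U1 0 := nbhs_singleton (conj_nbhs1 cj).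
  have := homeoK (conj_homeo cj) (mem_set U10).
  by rewrite (conj0 cj).
have [i0 [K [_ gF _]]] := analytic_germ f_an m0 a0 fE ltr01.
have [N [rep nN]] := numbering_exists R p_pr i0 (germ_m gF) (germ_K gF).
(* [U1] and [U2] are arbitrary here, so the ball for [g] is taken inside [U2] and small enough for
   [k] to send it into the ball where [f] is numbered. *)
have [d1 d10 hd1] := (Qp_continuous_withinP U2 k).1
  (homeo_contV (conj_homeo cj)) 0 U20 _ (pVX_gt0 R p_pr i0).
have [d2 d20 hd2] := (Qp_nbhsP _ _).1 (conj_nbhs2 cj).
have d0 : 0 < Num.min d1 d2 by rewrite lt_min d10.
have [i0' [K' [hi gG _]]] := analytic_germ g_an m'0 a'0 gE d0.
have [N' [rep' nN']] := numbering_exists R p_pr i0' (germ_m gG) (germ_K gG).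
rewrite lt_min in hi; case/andP: hi => hi1 hi2.
pose y n := rep' n; pose x n := k (y n).
have yU n : U2 (y n).
  by apply: hd2; rewrite subr0 (le_lt_trans (rep_le nN' n)).
have xU n : U1 (x n) := homeo_inv (conj_homeo cj) (yU n).
have hx n : h (x n) = y n := homeoVK (conj_homeo cj) (mem_set (yU n)).
have xi n : nrm (x n) <= q ^+ i0.
  have := hd1 (y n) (yU n); rewrite k0 !subr0 => /(_ _)/ltW; apply.
  by rewrite (le_lt_trans (rep_le nN' n)).
have x0 n : x n != 0.
  apply: contra_neq (rep_neq0 nN' n) => x0.
  by rewrite -[rep' n]/(y n) -hx x0 (conj0 cj).
(* If [x n] and [x s] have the same number, iterates of [x n] accumulate at [x s]; applying [h] puts
   [rep' s] in the orbit of [rep' n], whence [n = s]. *)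
have Ninj : injective (N \o x).
  move=> n s /= Nns; have [l xl] := Qp_level (x0 n) (xi n).
  have := (number_eq nN xl (x0 s) (xi s)).1 Nns.
  rewrite -(germ_norm gF xl) Qp_normB => close.
  have orb : Zp_orbit (peval f) (x n) (x s).
    apply/Qp_closureP => e e0.
    have D0 : 0 < nrm (peval f (x n) - x n) by rewrite (germ_norm gF xl) pVX_gt0.
    have [j hj] := pVX_small p_pr (divr_gt0 e0 D0).
    have [t ht] := germ_orbit_dense gF j (xi n) close.
    exists (iter t (peval f) (x n)); first by exists t.
    by rewrite (le_lt_trans ht) // -ltr_pdivlMr.
  have := conjugacy_same_orbit cj (xU n) (xU s) orb; rewrite !hx => orb'.
  have [_ _] := number_closure gG nN' (rep_neq0 nN' n) (rep_le nN' n) orb'.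
  by rewrite !(repK nN').
(* Replaces [C] by the larger [q ^- c], so that the assumed bound becomes a comparison of
   exponents. *)
have [c hc] := pVX_small p_pr (divr_gt0 ltr01 C0).
have [L hL] := exponent_gap K (i0' + c) m'0 alpha_gt.
have p1 := prime_gt1 p_pr.
(* An index below [p ^ (m' * L)] has [g]-level at most [L]; the assumed bound then limits the
   [f]-level [l] of its image by [k]. The predecessor leaves one value too few for the injection. *)
have few n : (n < p ^ (m' * L))%N -> (N (x n) < (p ^ (m' * L)).-1)%N.
  move=> nL; have [l xl] := Qp_level (x0 n) (xi n).
  have [l' yl'] := Qp_level (rep_neq0 nN' n) (rep_le nN' n).
  have l'L : (l' <= L)%N.
    have /andP[h1 _] := number_level nN' yl'; rewrite (repK nN') in h1.
    have h2 := orbits_below_ge p1 (germ_m gG) (germ_K gG) L.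
    have Slt := orbits_below_lt p1 (germ_m gG) (germ_K gG).
    rewrite -ltnS; apply: (incr_step_lt Slt).
    by apply: leq_ltn_trans h1 _; apply: leq_trans nL h2.
  have lL : l%:R * alpha <= (L + (i0' + c))%:R.
    have := hC _ (xU n); rewrite hx yl' xl => h1.
    have : q ^+ (i0' + L + c) <= (q ^+ (i0 + l)) `^ alpha.
      rewrite exprD; apply: (@le_trans _ _ (q ^+ (i0' + l') * C^-1)).
        rewrite ler_pM ?(ltW (pVX_gt0 _ p_pr _)) //.
          by rewrite pVX_le // leq_add2l.
        by move: (ltW hc); rewrite mul1r.
      by rewrite ler_pdivrMr // mulrC.
    rewrite -!powR_mulrn ?(ltW (pV_gt0 R p_pr)) // -powRrM => h2.
    rewrite leNgt; apply/negP => h3; move: h2; rewrite leNgt => /negP[].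
    apply: ltr_powR_lt1; rewrite ?pV_gt0 ?pV_lt1 //.
    apply: (@lt_le_trans _ _ (l%:R * alpha)).
      by rewrite [(i0' + L)%N]addnC -addnA.
    by rewrite ler_pM2r // ler_nat leq_addl.
  have h1 := hL _ lL.
  have /andP[_ h2] := number_level nN xl.
  have h3 := orbits_below_le p1 (germ_m gF) (germ_K gF) l.
  have h4 : (p ^ (m * l + K) < p ^ (m' * L))%N by rewrite ltn_exp2l.
  rewrite -ltnS prednK ?expn_gt0 ?prime_gt0 //.
  exact: leq_ltn_trans (leq_trans h2 h3) h4.
pose s (n : 'I_(p ^ (m' * L))) := Ordinal (few n (ltn_ord n)).
have s_inj : injective s by move=> n t /(congr1 val) /Ninj /val_inj.
have := leq_card s s_inj; rewrite !card_ord leqNgt ltn_predL.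
by rewrite expn_gt0 prime_gt0.
Qed.

End MainResults.

(** * Construction of the conjugacy with its estimates *)

Section Existence.
Variables (R : realType) (p : nat) (p_pr : prime p).
Local Notation Qp := (Qp R p_pr).
Local Notation nrm := (@Qp_norm R p p_pr).
Local Notation q := (p%:R^-1 : R).
Implicit Types (x y z : Qp) (f g : nat -> Qp).

(** The conjugacy is built from the matching before [m] and [m'] are compared; only the estimates
    are conditional on [m <= m']. *)
Lemma conjugacy_exists f g m m' a a' :
  Qp_analytic f -> Qp_analytic g -> (0 < m)%N -> (0 < m')%N ->
  a <> 0 -> a' <> 0 -> tangent_to_id f m a -> tangent_to_id g m' a' ->
  exists U1 U2 h k C, conjugacy f g U1 U2 h k /\ 0 < C /\
    ((m <= m')%N -> [/\ forall x, U1 x ->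
            nrm (h x) <= C * (nrm x `^ (m%:R / m'%:R)),
          forall x y, U1 x -> U1 y -> same_Zp_orbit (peval f) U1 x y ->
            nrm (h y - h x) <= C * (nrm (y - x) `^ (m%:R / m'%:R)) &
          forall x y, U2 x -> U2 y -> same_Zp_orbit (peval g) U2 x y ->
            nrm (k y - k x) <= C * (nrm (y - x) `^ (m%:R / m'%:R))]).
Proof.
move=> f_an g_an m0 m'0 a0 a'0 fE gE.
have [i0 [K [_ gF cF]]] := analytic_germ f_an m0 a0 fE ltr01.
have [i0' [K' [_ gG cG]]] := analytic_germ g_an m'0 a'0 gE ltr01.
have [N [rep nN]] := numbering_exists R p_pr i0 m0 (germ_K gF).
have [N' [rep' nN']] := numbering_exists R p_pr i0' m'0 (germ_K gG).
have /choice[h hM] x : exists y, nrm x <= q ^+ i0 ->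
    matched (peval f) rep (peval g) rep' x y.
  have [xi|xi] := boolP (nrm x <= q ^+ i0); last by exists 0.
  by have [y xy] := matched_total gF nN gG nN' xi; exists y.
have /choice[k kM] y : exists x, nrm y <= q ^+ i0' ->
    matched (peval g) rep' (peval f) rep y x.
  have [yi|yi] := boolP (nrm y <= q ^+ i0'); last by exists 0.
  by have [x xy] := matched_total gG nN' gF nN yi; exists x.
have cj := germs_conjugacy gF cF nN gG cG nN' hM kM.
exists [set x | nrm x <= q ^+ i0], [set x | nrm x <= q ^+ i0'], h, k.
exists (q ^- hoelder_shift m m' i0 i0' K K').
split=> //; split=> [|mm']; first by rewrite invr_gt0 pVX_gt0.
split.
- move=> x /= xi; have [->|x0] := eqVneq x 0.
    rewrite (conj0 cj) [X in X <= _]Qp_norm0.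
    by rewrite mulr_ge0 ?powR_ge0 // invr_ge0 ltW // pVX_gt0.
  have [l [l' [-> -> _ _ [ll _]]]] :=
    match_at_levels gF nN gG nN' (matched_at gF nN x0 (hM x xi)).
  by apply: pVX_le_powR => //; exact: hoelder_shift_norm.
- have cE l l' t : (m * l <= m' * l' + K' + m)%N ->
      (m' * l' <= m * l + K + m')%N -> _ :=
    fun h1 _ => hoelder_shift_fwd i0 i0' K m'0 t mm' h1.
  exact (matched_orbit_hoelder gF nN gG nN' hM m'0 cE).
(* The bound for the inverse exchanges the two germs but keeps the exponent [m / m'], so it calls
   for the other arithmetic inequality. *)
- have cE l l' t : (m' * l <= m * l' + K + m')%N ->
      (m * l' <= m' * l + K' + m)%N -> _ :=
    fun h1 _ => hoelder_shift_bwd i0 i0' K' m'0 t mm' h1.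
  exact (matched_orbit_hoelder gG nN' gF nN kM m'0 cE).
Qed.

End Existence.

Theorem theorem1p3 (R : realType) (p : nat) (p_pr : prime p)
    (f g : nat -> Qp R p_pr) (m m' : nat) (a a' : Qp R p_pr)
    (f_an : Qp_analytic f) (g_an : Qp_analytic g)
    (m1 : (1 <= m)%N) (m'1 : (1 <= m')%N) (a0 : a <> 0) (a'0 : a' <> 0)
    (fE : tangent_to_id f m a) (gE : tangent_to_id g m' a') :
  (exists (U1 U2 : set (Qp R p_pr)) (h k : Qp R p_pr -> Qp R p_pr),
     conjugacy f g U1 U2 h k) /\
  ((m <= m')%N ->
    (exists (U1 U2 : set (Qp R p_pr)) (h k : Qp R p_pr -> Qp R p_pr) (C : R),
      [/\ conjugacy f g U1 U2 h k,
          0 < C,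
          forall x, U1 x ->
            Qp_norm (h x) <= C * (Qp_norm x `^ (m%:R / m'%:R)),
          forall x y, U1 x -> U1 y -> same_Zp_orbit (peval f) U1 x y ->
            Qp_norm (h y - h x) <= C * (Qp_norm (y - x) `^ (m%:R / m'%:R)) &
          forall x y, U2 x -> U2 y -> same_Zp_orbit (peval g) U2 x y ->
            Qp_norm (k y - k x) <= C * (Qp_norm (y - x) `^ (m%:R / m'%:R))]) /\
    (forall alpha : R, m%:R / m'%:R < alpha ->
      ~ exists (U1 U2 : set (Qp R p_pr)) (h k : Qp R p_pr -> Qp R p_pr) (C : R),
          [/\ conjugacy f g U1 U2 h k,
              0 < C &
              forall x, U1 x -> Qp_norm (h x) <= C * (Qp_norm x `^ alpha)])).
Proof.
have [U1 [U2 [h [k [C [cj [C0 hC]]]]]]] :=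
  conjugacy_exists f_an g_an m1 m'1 a0 a'0 fE gE.
split=> [|mm']; first by exists U1, U2, h, k.
have [h1 h2 h3] := hC mm'; split=> [|alpha alpha_gt].
  by exists U1, U2, h, k, C.
move=> [V1 [V2 [h' [k' [D [cj' D0 hD]]]]]].
have := conjugacy_exponent_le f_an g_an m1 m'1 a0 a'0 fE gE cj' D0 hD.
by rewrite leNgt alpha_gt.
Qed.
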